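(* For every integer $n\ge 1$ there exists a $\pi/3$-equiangular polyhedron $P_n$ in $\mathbb{H}^3$ with the following combinatorial structure. For $n=1$, $P_1$ is a tetrahedron. For $n\ge 2$, $P_n$ has an ideal vertex $v_0$ such that: (i) exactly three faces $A_1,A_2,A_3$ of $P_n$ contain $v_0$, and each of them is an $(n+2)$-gon; (ii) the face $B_1$ (respectively $B_2$, $B_3$) which is adjacent to both $A_1$ and $A_2$ (respectively $A_2$ and $A_3$, $A_3$ and $A_1$) other than $A_3$ (respectively $A_1$, $A_2$) is a quadrilateral, and $B_1,B_2,B_3$ are distinct; (iii) every face other than $A_1,A_2,A_3,B_1,B_2,B_3$ that is adjacent to exactly one of $A_1,A_2,A_3$ is a pentagon (there are $3(n-2)$ such faces); (iv) every face other than $A_1,A_2,A_3$ that is not adjacent to any of $A_1,A_2,A_3$ is a hexagon (there are $(n-3)(n-2)/2$ such faces).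
   Context: Polyhedra are convex polyhedra in hyperbolic 3-space $\mathbb{H}^3$ of finite volume; vertices may be proper (in $\mathbb{H}^3$) or ideal (in $\partial\mathbb{H}^3$). A $\pi/3$-equiangular polyhedron is such a polyhedron all of whose dihedral angles equal $\pi/3$. Two faces are adjacent if they share an edge. *)

(* Defs.v *)
From HB Require Import structures.
From mathcomp Require Import all_boot all_order all_algebra.
From mathcomp Require Import all_classical all_reals all_analysis.
Import Order.TTheory GRing.Theory Num.Theory.
Import numFieldNormedType.Exports.

Set Implicit Arguments.
Unset Strict Implicit.
Unset Printing Implicit Defensive.

Local Open Scope classical_set_scope.
Local Open Scope card_scope.
Local Open Scope ring_scope.

(* Hyperbolic 3-space is represented by its projective (Klein) model: the open
   unit ball of R^3, in which totally geodesic subspaces are the traces of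
   affine subspaces and the ideal boundary is the unit sphere. *)

Section HyperbolicSpace.
Variable R : realType.
Implicit Types (x y v : 'rV[R]_3) (e f : 'rV[R]_3 * R) (P F E : set 'rV[R]_3).

Definition dot x y : R := (x *m y^T) 0 0.

Definition H3 : set 'rV[R]_3 := [set x | dot x x < 1].

Definition ideal_boundary : set 'rV[R]_3 := [set x | dot x x = 1].

(* A pair e = (u, c) stands for the affine half-space u . x <= c.  It is the
   vector (u, c) of Minkowski space R^{3,1}, an outward normal of the
   corresponding hyperbolic half-space. *)
Definition lorentz e f : R := dot e.1 f.1 - e.2 * f.2.

(* The plane u . x = c meets H3 if and only if c^2 < u . u. *)
Definition spacelike e : Prop := 0 < lorentz e e.

Definition half_space e : set 'rV[R]_3 := [set x | H3 x /\ dot e.1 x <= e.2].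

Definition hplane e : set 'rV[R]_3 := [set x | H3 x /\ dot e.1 x = e.2].

Definition row3 (p : R * R * R) : 'rV[R]_3 :=
  \row_(i < 3) [:: p.1.1; p.1.2; p.2]`_i.

(* The volume form of the Klein model is dx dy dz / (1 - |x|^2)^2. *)
Definition hyp_volume P : \bar R :=
  (\int[(lebesgue_measure \x lebesgue_measure) \x lebesgue_measure]_(p in
       [set p : R * R * R | P (row3 p)])
     (((1 - dot (row3 p) (row3 p)) ^+ 2)^-1)%:E)%E.

Definition convex_polyhedron P : Prop :=
  (exists s : seq ('rV[R]_3 * R),
     (forall e, e \in s -> spacelike e) /\
     P = H3 `&` \bigcap_(e in [set` s]) half_space e) /\
  P° !=set0.

Definition polyhedron P : Prop :=
  convex_polyhedron P /\ (hyp_volume P < +oo)%E.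

(* S contains d + 1 affinely independent points whose affine hull contains S. *)
Definition affine_dim (S : set 'rV[R]_3) (d : nat) : Prop :=
  exists (a : 'rV[R]_3) (x : 'I_d -> 'rV[R]_3),
    [/\ S a, forall i, S (x i),
        row_free (\matrix_(i < d) (x i - a)) &
        forall y, S y -> (y - a <= \matrix_(i < d) (x i - a))%MS].

Definition supports e P : Prop := spacelike e /\ P `<=` half_space e.

Definition face_of_dim (d : nat) P F : Prop :=
  exists e, [/\ supports e P, F = P `&` hplane e & affine_dim F d].

Definition is_face P F : Prop := face_of_dim 2 P F.

Definition is_edge P E : Prop := face_of_dim 1 P E.

Definition adjacent_faces P F G : Prop :=
  F <> G /\ exists E, [/\ is_edge P E, E `<=` F & E `<=` G].

Definition is_gon P F (k : nat) : Prop :=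
  [set E | is_edge P E /\ E `<=` F] #= `I_k.

(* When P has finite volume, its closure in the closed ball meets the sphere
   only in finitely many points, which are the ideal vertices of P. *)
Definition ideal_vertex P v : Prop := ideal_boundary v /\ closure P v.

(* The interior angle between two faces is the supplement of the angle between
   their outward normals. *)
Definition dihedral_angle e f : R :=
  pi - acos (lorentz e f / (Num.sqrt (lorentz e e) * Num.sqrt (lorentz f f))).

Definition equiangular P (theta : R) : Prop :=
  polyhedron P /\
  forall e f, supports e P -> supports f P ->
    is_face P (P `&` hplane e) -> is_face P (P `&` hplane f) ->
    adjacent_faces P (P `&` hplane e) (P `&` hplane f) ->
    dihedral_angle e f = theta.

Definition tetrahedron P : Prop :=
  [set F | is_face P F] #= `I_4 /\ (forall F, is_face P F -> is_gon P F 3).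

End HyperbolicSpace.

(* Main.v *)
Require Import Defs.
From HB Require Import structures.
From mathcomp Require Import all_boot all_order all_algebra.
From mathcomp Require Import all_classical all_reals all_analysis.
From mathcomp Require Import measurable_realfun.
From mathcomp Require Import ring lra zify.
Import Order.TTheory GRing.Theory Num.Theory.
Import numFieldNormedType.Exports.

(** Put the ideal vertex [v0] at infinity of the upper half-space.  The three
faces through it become vertical planes over the sides of an equilateral
triangle, and every other face becomes a hemisphere centred on the bounding
plane.  Two such hemispheres of the same radius [r], seen from outside, make
the dihedral angle pi/3 exactly when their centres are at distance [sqrt 3 * r],
and a hemisphere makes this angle with a vertical plane exactly when its centre
is at distance [r / 2] from it, on the side of the polyhedron.  Cut a triangle
whose side is [n] units into [n ^ 2] unit triangles and take the circumscribed
circles of the [n (n + 1) / 2] unit triangles which are oriented like the large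
one: neighbouring centres are one side apart, and a centre is at distance half
the radius from the sides of its own triangle.  Hence all the angles are pi/3,
and the faces are arranged like the cells of a triangular piece of honeycomb.
The finite ideal vertices are the nodes of the subdivision and the centres of
the unit triangles of the opposite orientation.

In barycentric coordinates with sum [n], the circles are indexed by the triples
[p] of natural numbers with sum [m = n - 1], and the exterior of the circle of
[p] is [\sum_k (a k - p k) ^+ 2 >= 1].  That every candidate vertex lies outside
or on all the circles then says that a nonzero integer vector has square norm at
least 1, and a circle touches as many others as [p] has neighbours in the
lattice of triples: a cell with [z] zero coordinates has [6 - z] edges, [z] of
which lie on the sides of the large triangle.

The combinatorics is read off the Lorentz products of the unit normals, which
are -1/2 for adjacent planes and at most -1 for the other pairs.  A point of the
hyperbolic space has a positive definite orthogonal complement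
([lorentz_le0_eq0]).  Therefore two planes whose normals have product at most -1
do not meet inside the polyhedron ([active_adj]), and no point of it lies on
three of the planes, as the sum of three normals with products -1/2 is isotropic
([active_two]).  So at most two constraints are ever active, and all the faces
and edges are the evident ones ([is_faceP], [is_edgeP]) as soon as each adjacent
pair of planes carries an edge; the two ideal ends of that edge are exhibited in
[ends_sides], [ends_side_cell] and [ends_cells].

The volume is finite because inside the polyhedron [1 - dot x x] bounds, up to a
constant, the distance from [x] to the nearest ideal vertex ([cusp_bound]): the
part where it is about [2 ^- k] lies in boundedly many cubes of side comparable
to [2 ^- k], the density is there about [4 ^ k], and the sum over [k] of
[4 ^ k * 8 ^- k] converges ([finite_hyp_volume]). *)

Set Implicit Arguments.
Unset Strict Implicit.
Unset Printing Implicit Defensive.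

Local Open Scope classical_set_scope.
Local Open Scope card_scope.
Local Open Scope ring_scope.

(** * The bilinear forms *)

Section Dot.
Variable R : realType.
Implicit Types (x y u v : 'rV[R]_3) (e f : 'rV[R]_3 * R).

Lemma dotC x y : dot x y = dot y x.
Proof. by rewrite /dot !mxE; apply: eq_bigr => i _; rewrite !mxE mulrC. Qed.

Lemma dotDr u x y : dot u (x + y) = dot u x + dot u y.
Proof. by rewrite /dot linearD mulmxDr mxE. Qed.

Lemma dotZr u a x : dot u (a *: x) = a * dot u x.
Proof. by rewrite /dot linearZ /= -scalemxAr mxE. Qed.

Lemma dotNr u x : dot u (- x) = - dot u x.
Proof. by rewrite -scaleN1r dotZr mulN1r. Qed.

Lemma dotBr u x y : dot u (x - y) = dot u x - dot u y.
Proof. by rewrite dotDr dotNr. Qed.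

Lemma dotDl x y u : dot (x + y) u = dot x u + dot y u.
Proof. by rewrite !(dotC _ u) dotDr. Qed.

Lemma dotZl a x u : dot (a *: x) u = a * dot x u.
Proof. by rewrite !(dotC _ u) dotZr. Qed.

Lemma dotBl x y u : dot (x - y) u = dot x u - dot y u.
Proof. by rewrite !(dotC _ u) dotBr. Qed.

Lemma dot0r u : dot u 0 = 0.
Proof. by rewrite /dot trmx0 mulmx0 mxE. Qed.

Lemma dot0l u : dot 0 u = 0.
Proof. by rewrite dotC dot0r. Qed.

Lemma dotNl x u : dot (- x) u = - dot x u.
Proof. by rewrite !(dotC _ u) dotNr. Qed.

Definition dotE :=
  (dotBl, dotBr, dotDl, dotDr, dotZl, dotZr, dotNl, dotNr, dot0l, dot0r).

Lemma dotxx x : dot x x = \sum_i x 0 i ^+ 2.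
Proof. by rewrite /dot mxE; apply: eq_bigr => i _; rewrite mxE expr2. Qed.

Lemma dot_ge0 x : 0 <= dot x x.
Proof. by rewrite dotxx sumr_ge0 // => i _; rewrite sqr_ge0. Qed.

Lemma dot_eq0 x : (dot x x == 0) = (x == 0).
Proof.
apply/idP/eqP => [|->]; last by rewrite dot0r.
rewrite dotxx psumr_eq0 => [/allP x0|i _]; last exact: sqr_ge0.
apply/rowP => i; rewrite mxE; apply/eqP; rewrite -sqrf_eq0.
exact: (x0 i (mem_index_enum i)).
Qed.

Lemma lorentzC e f : lorentz e f = lorentz f e.
Proof. by rewrite /lorentz dotC mulrC. Qed.

Lemma lorentzDr e f g : lorentz e (f + g) = lorentz e f + lorentz e g.
Proof. by rewrite /lorentz dotDr mulrDr; ring. Qed.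

Lemma lorentzDl e f g : lorentz (f + g) e = lorentz f e + lorentz g e.
Proof. by rewrite !(lorentzC _ e) lorentzDr. Qed.

Lemma sqnorm_between x y (t : R) :
  dot (x + t *: (y - x)) (x + t *: (y - x))
  = (1 - t) * dot x x + t * dot y y - t * (1 - t) * dot (x - y) (x - y).
Proof. by rewrite !dotE (dotC y x); ring. Qed.

Lemma dot_between_le u x y (c t : R) : 0 < t < 1 ->
  dot u x <= c -> dot u y <= c -> dot u (x + t *: (y - x)) <= c.
Proof.
move=> /andP[t0 t1] ux uy; rewrite !dotE.
have : t * dot u y <= t * c by rewrite ler_pM2l.
have : (1 - t) * dot u x <= (1 - t) * c by rewrite ler_pM2l// subr_gt0.
by move=> ? ?; lra.
Qed.

Lemma H3_between x y (t : R) : 0 < t < 1 ->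
  dot x x <= 1 -> H3 y -> H3 (x + t *: (y - x)).
Proof.
rewrite /H3/= => /andP[t0 t1] Hx Hy; rewrite sqnorm_between.
have h1 : 0 <= t * (1 - t) * dot (x - y) (x - y).
  by rewrite !mulr_ge0 ?dot_ge0// ltW// subr_gt0.
have h2 : t * dot y y < t * 1 by rewrite ltr_pM2l.
have h3 : (1 - t) * dot x x <= (1 - t) * 1 by rewrite ler_pM2l// subr_gt0.
by lra.
Qed.

(** The Lorentz form is positive definite on the orthogonal complement of the
timelike vector [(x, 1)]. *)
Lemma lorentz_le0_eq0 e x :
  H3 x -> dot e.1 x = e.2 -> lorentz e e <= 0 -> e = 0.
Proof.
rewrite /H3/= /lorentz; case: e => u c /= x1 uxc le0.
have h : dot u u - c * c
       = dot (u - c *: x) (u - c *: x) + c ^+ 2 * (1 - dot x x).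
  by rewrite !dotE (dotC x u) uxc; ring.
have h1 := dot_ge0 (u - c *: x).
have h2 : 0 <= c ^+ 2 * (1 - dot x x) by rewrite mulr_ge0 ?sqr_ge0 // subr_ge0 ltW.
have /eqP : c ^+ 2 * (1 - dot x x) = 0 by lra.
have x1' : 1 - dot x x != 0 by rewrite subr_eq0 gt_eqF.
rewrite mulf_eq0 (negbTE x1') orbF sqrf_eq0 => /eqP c0.
have : dot (u - c *: x) (u - c *: x) = 0 by lra.
by move/eqP; rewrite dot_eq0 c0 scale0r subr0 => /eqP ->.
Qed.

End Dot.

Lemma card_set_fin (T : finType) (A : {set T}) : [set` A] #= `I_#|A|.
Proof.
have -> : [set` A] = enum_val @` [set: 'I_#|A|].
  apply/seteqP; split=> x; last by move=> [i _ <-]; exact: enum_valP.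
  by move=> Ax; exists (enum_rank_in Ax x) => //; rewrite enum_rankK_in.
apply: card_eq_trans (inj_card_eq _) _; first by move=> i j _ _ /enum_val_inj.
by rewrite card_eq_sym; exact: card_II.
Qed.

(** * Continuity, an angle and dimensions *)

Section Topology.
Variable R : realType.
Implicit Types u : 'rV[R]_3.

Lemma dot_continuous u : continuous (dot u).
Proof.
have -> : dot u = fun y => \sum_i u 0 i * y 0 i.
  by apply/funext => y; rewrite /dot mxE; apply: eq_bigr => i _; rewrite mxE.
apply: continuous_big => [|i _ x]; first exact: add_continuous.
apply: (@continuousM _ _ (cst (u 0 i)) (fun y : 'rV[R]_3 => y 0 i)).
  exact: cst_continuous.
exact: coord_continuous.
Qed.

Lemma sqnorm_continuous : continuous (fun x : 'rV[R]_3 => dot x x).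
Proof.
have -> : (fun y : 'rV[R]_3 => dot y y) = fun y => \sum_i y 0 i * y 0 i.
  by apply/funext => y; rewrite dotxx; apply: eq_bigr => i _; rewrite expr2.
apply: continuous_big => [|i _ x]; first exact: add_continuous.
by apply: (@continuousM _ _ (fun y : 'rV[R]_3 => y 0 i) (fun y : 'rV[R]_3 => y 0 i));
  exact: coord_continuous.
Qed.

Lemma closed_plane u c : closed [set x | dot u x = c].
Proof.
apply: (@closed_comp _ _ (dot u) [set y | y = c]); last exact: closed_eq.
by move=> y _; exact: dot_continuous.
Qed.

End Topology.

Lemma cos_pi3 (R : realType) : cos (pi / 3) = 1 / 2 :> R.
Proof.
set t : R := pi / 3.
have c0 : 0 < cos t.
  have := pi_gt0 R => pi0.
  by apply: cos_gt0_pihalf; apply/andP; split; rewrite /t; lra.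
have : cos (t + (t + t)) = -1.
  have -> : t + (t + t) = pi by rewrite /t; field.
  exact: cospi.
(* cos (3 t) = 4 cos^3 t - 3 cos t = -1 factors as below *)
rewrite cosD cosD sinD => h.
have hs := cos2Dsin2 t; move: h hs c0; set c := cos t; set s := sin t => h hs c0.
have s2 : s ^+ 2 = 1 - c ^+ 2 by rewrite -hs addrC addKr.
have : (c + 1) * (2 * c - 1) ^+ 2 = 0.
  transitivity (c * (c * c - s * s) - s * (s * c + c * s) + 1); last first.
    by rewrite h; ring.
  transitivity (c ^+ 3 - 3 * c * s ^+ 2 + 1); last by ring.
  by rewrite s2; ring.
have c1 : c + 1 != 0 by rewrite gt_eqF// addr_gt0.
move=> /eqP; rewrite mulf_eq0 (negbTE c1) /= sqrf_eq0 => /eqP h2; lra.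
Qed.

Section AffineDim.
Variable R : realType.
Implicit Types (S : set 'rV[R]_3) (u v y : 'rV[R]_3).

(** The points need not span [S]: this applies to points of a supposed face that
all lie on an edge, and to points of a face that all lie on a supposed edge. *)
Lemma dim_le S d (a : 'rV[R]_3) (x : 'I_d -> 'rV[R]_3) d' :
  S a -> (forall r, S (x r)) -> row_free (\matrix_(r < d) (x r - a)) ->
  affine_dim S d' -> (d <= d')%N.
Proof.
move=> Sa Sx fx [b [z [Sb Sz _ Sbz]]].
have /mxrankS : (\matrix_(r < d) (x r - a)
    <= \matrix_(r < d') (z r - b))%MS.
  apply/row_subP => r; rewrite rowK.
  have -> : x r - a = (x r - b) - (a - b) by rewrite opprB addrA subrK.
  by rewrite addmx_sub// ?eqmx_opp ?Sbz.
move: fx; rewrite -row_leq_rank => fx /(leq_trans fx) /leq_trans; apply.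
exact: rank_leq_row.
Qed.

Lemma row_free1 u : u != 0 -> row_free u.
Proof. by move=> u0; rewrite /row_free rank_rV u0. Qed.

Lemma row_free2 (f : 'I_2 -> 'rV[R]_3) :
  (forall a b, a *: f 0 + b *: f 1 = 0 -> a = 0 /\ b = 0) ->
  row_free (\matrix_(r < 2) f r).
Proof.
move=> h; rewrite -kermx_eq0; apply/rowV0P => v /sub_kermxP.
rewrite mulmx_sum_row big_ord_recl big_ord1 !rowK.
have -> : lift ord0 ord0 = 1 :> 'I_2 by apply/val_inj.
move=> /h[v0 v1]; apply/rowP => r; rewrite mxE.
by case: (unliftP ord0 r) => [s ->|-> //]; rewrite ord1 -[RHS]v1; congr (v _ _); apply/val_inj.
Qed.

(** Affine spans of faces and edges are found by counting dimensions: enough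
independent vectors orthogonal to the normals span all such vectors. *)
Lemma sub_orthogonal d r (M : 'M[R]_(d, 3)) (U : 'M[R]_(r, 3)) y :
  row_free M -> row_free U -> (d + r = 3)%N -> M *m U^T = 0 ->
  y *m U^T = 0 -> (y <= M)%MS.
Proof.
move=> fM fU dr MU yU.
have kM : (M <= kermx U^T)%MS by apply/sub_kermxP.
have rk : \rank (kermx U^T) = \rank M.
  by rewrite mxrank_ker mxrank_tr (eqP fM) (eqP fU) -dr addnK.
have /sub_kermxP := yU; move=> /submx_trans; apply.
by rewrite -(geq_leqif (mxrank_leqif_sup kM)) rk.
Qed.

Lemma mul_tr_rows d r (f : 'I_d -> 'rV[R]_3) (g : 'I_r -> 'rV[R]_3) :
  (forall s t, dot (f s) (g t) = 0) ->
  (\matrix_(s < d) f s) *m (\matrix_(t < r) g t)^T = 0.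
Proof.
move=> h; apply/matrixP => s t; rewrite !mxE -[RHS](h s t) /dot mxE.
by apply: eq_bigr => k _; rewrite !mxE.
Qed.

End AffineDim.

(** * Polyhedra with prescribed Gram matrix *)

(** Unit outward normals of half-spaces containing the origin, such that adjacent
planes make the angle pi/3, the others do not meet, each adjacent pair of planes
contains the segment between two points of the sphere that satisfy all the
constraints, and each plane is adjacent to at least two others. *)
Record equiangular_family (R : realType) (I : finType)
    (e : I -> 'rV[R]_3 * R) (adj : rel I) : Prop := EquiangularFamily {
  ef_norm : forall i, lorentz (e i) (e i) = 1;
  ef_adj : forall i j, adj i j -> lorentz (e i) (e j) = - (1 / 2);
  ef_far : forall i j, i != j -> ~~ adj i j -> lorentz (e i) (e j) <= - 1;
  ef_origin : forall i, 0 < (e i).2;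
  ef_ends : forall i j, adj i j -> exists w1 w2,
    [/\ w1 != w2, dot w1 w1 = 1, dot w2 w2 = 1,
        (forall k, dot (e k).1 w1 <= (e k).2 /\ dot (e k).1 w2 <= (e k).2) &
        [/\ dot (e i).1 w1 = (e i).2, dot (e j).1 w1 = (e j).2,
            dot (e i).1 w2 = (e i).2 & dot (e j).1 w2 = (e j).2]];
  ef_deg : forall i j, exists k, k != j /\ adj i k
}.

Section Family.
Variables (R : realType) (I : finType) (e : I -> 'rV[R]_3 * R) (adj : rel I).
Implicit Types (x y u v m w : 'rV[R]_3) (i j k : I) (f : 'rV[R]_3 * R).

Definition family_polyhedron : set 'rV[R]_3 :=
  [set x | H3 x /\ forall i, dot (e i).1 x <= (e i).2].
Local Notation P := family_polyhedron.

Definition family_face i : set 'rV[R]_3 := P `&` hplane (e i).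
Definition family_edge i j : set 'rV[R]_3 := family_face i `&` family_face j.

Hypothesis fam : equiangular_family e adj.

Let e_norm := ef_norm fam.
Let e_adj := ef_adj fam.
Let e_far := ef_far fam.
Let e_origin := ef_origin fam.
Let e_ends := ef_ends fam.
Let e_deg := ef_deg fam.

Lemma adj_neq i j : adj i j -> i != j.
Proof.
move=> /e_adj aij; apply/eqP => ij; move: aij; rewrite {}ij e_norm => h.
by lra.
Qed.

Lemma adj_sym i j : adj i j = adj j i.
Proof.
suff s : forall i j, adj i j -> adj j i by apply/idP/idP; exact: s.
move=> {i j} i j aij; apply: contraT => naji.
have ne := adj_neq aij; rewrite eq_sym in ne.
have := e_far ne naji; rewrite lorentzC e_adj// => ?; lra.
Qed.

(** Otherwise the sum of the two normals is not spacelike, although it is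
orthogonal to a point of the hyperbolic space. *)
Lemma active_adj x i j : H3 x -> i != j ->
  dot (e i).1 x = (e i).2 -> dot (e j).1 x = (e j).2 -> adj i j.
Proof.
move=> Hx nij xi xj; apply: contraT => naij.
(* 1 + 1 + 2 * (-1) = 0, while the constant term of the sum is positive *)
have h : lorentz (e i + e j) (e i + e j) <= 0.
  rewrite lorentzDl !lorentzDr !e_norm (lorentzC (e j)).
  by have := e_far nij naij => ?; lra.
have hx : dot (e i + e j).1 x = (e i + e j).2 by rewrite /= dotDl xi xj.
by have /(congr1 snd)/eqP/= := lorentz_le0_eq0 Hx hx h; rewrite gt_eqF// addr_gt0.
Qed.

(** Since the three planes are pairwise adjacent, the sum of their normals is
isotropic and orthogonal to a point of the hyperbolic space; so it vanishes,
which the position of the origin excludes. *)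
Lemma active_two x i j k : H3 x -> i != j ->
  dot (e i).1 x = (e i).2 -> dot (e j).1 x = (e j).2 ->
  dot (e k).1 x = (e k).2 -> k = i \/ k = j.
Proof.
move=> Hx nij xi xj xk.
have [->|nki] := eqVneq k i; first by left.
have [->|nkj] := eqVneq k j; first by right.
have aij := active_adj Hx nij xi xj.
have aki := active_adj Hx nki xk xi.
have akj := active_adj Hx nkj xk xj.
(* 3 * 1 + 6 * (-1/2) = 0 *)
have h : lorentz (e i + e j + e k) (e i + e j + e k) <= 0.
  rewrite !lorentzDl !lorentzDr !e_norm (lorentzC (e j) (e i)).
  rewrite (lorentzC (e i) (e k)) (lorentzC (e j) (e k)) !e_adj //; lra.
have hx : dot (e i + e j + e k).1 x = (e i + e j + e k).2.
  by rewrite /= !dotDl xi xj xk.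
by have /(congr1 snd)/eqP/= := lorentz_le0_eq0 Hx hx h; rewrite gt_eqF// !addr_gt0.
Qed.

(** There are finitely many constraints: the inactive ones are strict and survive
a short move, the active ones are not worsened by it. *)
Lemma move_inside m v : P m ->
  (forall i, dot (e i).1 m = (e i).2 -> dot (e i).1 v <= 0) ->
  exists2 t : R, 0 < t & P (m + t *: v).
Proof.
move=> [Hm Pm] hv.
have bound (a b : R) : a < b -> forall c : R,
    \forall t \near (0 : R)^'+, a + t * c < b.
  move=> ab c.
  have c0 : 0 < 1 + `|c| by have := normr_ge0 c => ?; lra.
  near=> t.
  have t0 : 0 < t by near: t; exact: nbhs_right_gt.
  have tb : t < (b - a) / (1 + `|c|).
    near: t; apply: nbhs_right_lt; rewrite divr_gt0 ?subr_gt0//.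
  rewrite ltr_pdivlMr// in tb.
  have : t * c <= t * `|c| by rewrite ler_pM2l// ler_norm.
  by move=> ?; lra.
have near_i : \forall t \near (0 : R)^'+,
    forall i, dot (e i).1 (m + t *: v) <= (e i).2.
  apply: filter_forall => i.
  have [mi|mi] := eqVneq (dot (e i).1 m) (e i).2.
    near=> t; have t0 : 0 < t by near: t; exact: nbhs_right_gt.
    by rewrite dotDr dotZr mi gerDl pmulr_rle0// hv.
  have lti : dot (e i).1 m < (e i).2 by rewrite lt_neqAle mi Pm.
  near=> t.
  have tb : dot (e i).1 m + t * dot (e i).1 v < (e i).2.
    by near: t; exact: bound.
  by rewrite dotDr dotZr ltW.
have near_H : \forall t \near (0 : R)^'+, H3 (m + t *: v).
  near=> t; rewrite /H3/= !dotE (dotC v m).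
  have t0 : 0 < t by near: t; exact: nbhs_right_gt.
  have t1 : t < 1 by near: t; exact: nbhs_right_lt.
  have tb : dot m m + t * (2 * dot m v + dot v v) < 1.
    by near: t; exact: bound.
  have vv := dot_ge0 v.
  have : t * (t * dot v v) <= t * dot v v.
    by rewrite ler_pM2l// ler_piMl// ltW.
  by move=> ?; lra.
have : \forall t \near (0 : R)^'+, 0 < t /\ P (m + t *: v).
  near=> t; split; first by near: t; exact: nbhs_right_gt.
  by split; near: t.
by move=> /filter_ex[t [t0 Pt]]; exists t.
Unshelve. all: by end_near. Qed.

Lemma polyhedron_between x y (t : R) : P x -> P y -> 0 < t < 1 -> P (x + t *: (y - x)).
Proof.
move=> [Hx Px] [Hy Py] t01; split; first by apply: H3_between => //; exact: ltW.
by move=> i; exact: dot_between_le.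
Qed.

Lemma active_between f x y (t : R) : 0 < t < 1 ->
  dot f.1 x <= f.2 -> dot f.1 y <= f.2 ->
  dot f.1 (x + t *: (y - x)) = f.2 -> dot f.1 x = f.2 /\ dot f.1 y = f.2.
Proof.
move=> /andP[t0 t1] fx fy; rewrite !dotE => h.
have h2 : t * dot f.1 y <= t * f.2 by rewrite ler_pM2l.
have h3 : (1 - t) * dot f.1 x <= (1 - t) * f.2 by rewrite ler_pM2l// subr_gt0.
have e2 : t * dot f.1 y = t * f.2 by lra.
have e3 : (1 - t) * dot f.1 x = (1 - t) * f.2 by lra.
split; [apply: (mulfI _ e3)|apply: (mulfI _ e2)].
  by rewrite subr_eq0 gt_eqF.
by rewrite gt_eqF.
Qed.

(** Otherwise [m] would be interior, and moving from it along the normal of [f]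
would leave the half-space of [f]. *)
Lemma support_active f m : supports f P -> P m -> dot f.1 m = f.2 ->
  exists i, dot (e i).1 m = (e i).2.
Proof.
move=> [sf Pf] Pm fm; apply: contrapT => /forallNP na.
have [//|t t0 /Pf[_]] := @move_inside m f.1 Pm.
  by move=> i /na.
rewrite dotDr dotZr fm gerDl pmulr_rle0// => h.
by move: sf; rewrite /spacelike /lorentz; have := sqr_ge0 f.2; rewrite expr2 => ? ?; lra.
Qed.

(** One active constraint determines the supporting plane: [f] is nonpositive on
the whole half-space of directions on which [e i] is, hence proportional to it. *)
Lemma support_single f m i : supports f P -> P m -> dot f.1 m = f.2 ->
  dot (e i).1 m = (e i).2 -> (forall k, dot (e k).1 m = (e k).2 -> k = i) ->
  exists2 l : R, 0 < l & f = (l *: (e i).1, l * (e i).2).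
Proof.
move=> [sf Pf] Pm fm im only.
(* near m the polyhedron is the half-space of e i *)
have dir v : dot (e i).1 v <= 0 -> dot f.1 v <= 0.
  move=> v0; have [|t t0 /Pf[_]] := @move_inside m v Pm.
    by move=> k /only ->.
  by rewrite dotDr dotZr fm gerDl pmulr_rle0.
have ii : 0 < dot (e i).1 (e i).1.
  have := e_norm i; rewrite /lorentz => h.
  by have := sqr_ge0 (e i).2; rewrite expr2 => ?; lra.
pose l := dot f.1 (e i).1 / dot (e i).1 (e i).1.
have lE : l * dot (e i).1 (e i).1 = dot f.1 (e i).1 by rewrite divfK// gt_eqF.
have f1 : f.1 = l *: (e i).1.
  apply/eqP; rewrite -subr_eq0 -dot_eq0 eq_le dot_ge0 andbT.
  have /dir : dot (e i).1 (f.1 - l *: (e i).1) <= 0.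
    by rewrite dotBr dotZr lE (dotC f.1) subrr.
  rewrite dotBl dotZl !dotBr !dotZr lE (dotC (e i).1 f.1) => h; lra.
have l0 : 0 <= l.
  rewrite divr_ge0 ?(ltW ii)// -oppr_le0 -dotNr; apply: dir.
  by rewrite dotNr oppr_le0 ltW.
exists l.
  rewrite lt_def l0 andbT; apply/eqP => l00.
  move: sf; rewrite /spacelike /lorentz f1 l00 scale0r dot0l.
  by have := sqr_ge0 f.2; rewrite expr2 => ? ?; lra.
by rewrite [f]surjective_pairing -fm f1 dotZl im.
Qed.

(** The ends of an edge are ideal, so they do not belong to the polyhedron; the
open segment between them does, by strict convexity of the ball. *)
Lemma edge_points i j : adj i j ->
  exists x y, [/\ x != y, family_edge i j x & family_edge i j y].
Proof.
move=> /e_ends[w1 [w2 [w12 n1 n2 cw [i1 j1 i2 j2]]]].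
have inE (t : R) : 0 < t < 1 -> family_edge i j (w1 + t *: (w2 - w1)).
  move=> t01; have cn k : dot (e k).1 (w1 + t *: (w2 - w1)) <= (e k).2.
    by apply: dot_between_le => //; case: (cw k).
  have Hw : H3 (w1 + t *: (w2 - w1)).
    case/andP: t01 => t0 t1; rewrite /H3/= sqnorm_between.
    have : 0 < t * (1 - t) * dot (w1 - w2) (w1 - w2).
      rewrite !mulr_gt0 ?subr_gt0// lt_def dot_ge0 andbT dot_eq0.
      by rewrite subr_eq0.
    by rewrite n1 n2 => ?; lra.
  split; (split; [by [] | split; first by []]);
    rewrite !dotE ?i1 ?i2 ?j1 ?j2; ring.
exists (w1 + (1/2) *: (w2 - w1)), (w1 + (1/3) *: (w2 - w1)); split.
- rewrite (inj_eq (addrI _)) -subr_eq0 -scalerBl scaler_eq0 negb_or.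
  apply/andP; split; last by rewrite subr_eq0 eq_sym.
  by apply/eqP => ?; lra.
- by apply: inE; apply/andP; split; lra.
- by apply: inE; apply/andP; split; lra.
Qed.

Lemma normal_neq0 i : (e i).1 != 0.
Proof.
apply/eqP => u0; have := e_norm i; rewrite /lorentz {}u0 dot0l.
by have := sqr_ge0 (e i).2; rewrite expr2 => h h'; lra.
Qed.

(** The Gram determinant of two adjacent normals is [1 - (1 / 2) ^+ 2], and a point
common to both planes transfers independence to the Euclidean parts. *)
Lemma normals_free i j m : adj i j ->
  dot (e i).1 m = (e i).2 -> dot (e j).1 m = (e j).2 ->
  row_free (\matrix_(r < 2) (if r == 0 then (e i).1 else (e j).1)).
Proof.
move=> aij im jm; apply: row_free2 => a b /=.
move=> /[dup] h /(congr1 (fun u => dot u m)); rewrite !dotE im jm => h2.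
have : lorentz (a *: (e i).1 + b *: (e j).1, a * (e i).2 + b * (e j).2)
               (a *: (e i).1 + b *: (e j).1, a * (e i).2 + b * (e j).2) = 0.
  by rewrite /lorentz /= h h2 !dotE; ring.
have ni := e_norm i; have nj := e_norm j; have nij := e_adj aij.
rewrite /lorentz /= in ni nj nij *; rewrite !dotE (dotC (e j).1 (e i).1) => h3.
have h4 : a ^+ 2 + b ^+ 2 - a * b = 0.
  transitivity (a ^+ 2 * (dot (e i).1 (e i).1 - (e i).2 * (e i).2)
    + b ^+ 2 * (dot (e j).1 (e j).1 - (e j).2 * (e j).2)
    + 2 * (a * b) * (dot (e i).1 (e j).1 - (e i).2 * (e j).2)).
    by rewrite ni nj nij; field.
  by rewrite -[RHS]h3; ring.
have h5 : (a - b / 2) ^+ 2 + 3 / 4 * b ^+ 2 = 0 by rewrite -h4; field.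
have := sqr_ge0 (a - b / 2); have := sqr_ge0 b => b2 ab2.
have /eqP : b ^+ 2 = 0 by lra.
rewrite sqrf_eq0 => /eqP b0; split; last by [].
have /eqP : a ^+ 2 = 0 by rewrite -h4 b0; ring.
by rewrite sqrf_eq0 => /eqP.
Qed.

(** Two edges of the same face provide three points that are not aligned. *)
Lemma face_dim i : affine_dim (family_face i) 2.
Proof.
have [k [_ aik]] := e_deg i i; have [l [lk ail]] := e_deg i k.
have [a [x [ax [[Pa ia] [_ ka]] [[Px ix] [_ kx]]]]] := edge_points aik.
have [y [_ [_ [[Py iy] [_ ly]] _]]] := edge_points ail.
(* y lies on another edge of the face, hence off the line of a and x *)
have ky : dot (e k).1 y != (e k).2.
  apply/eqP => ky; have [] := active_two Py.1 (adj_neq ail) iy.2 ly.2 ky.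
    by move=> ki; move: (adj_neq aik); rewrite ki eqxx.
  by move=> kl; move: lk; rewrite kl eqxx.
have free : row_free (\matrix_(r < 2) ((if r == 0 then x else y) - a)).
  apply: row_free2 => b c /= h.
  have := congr1 (dot (e k).1) h; rewrite !dotE kx.2 ka.2 subrr mulr0 add0r.
  move=> /eqP; rewrite mulf_eq0 subr_eq0 (negbTE ky) orbF => /eqP c0; split=> //.
  move: h; rewrite c0 scale0r addr0 => /eqP.
  by rewrite scaler_eq0 subr_eq0 (eq_sym x) (negbTE ax) orbF => /eqP.
exists a, (fun r : 'I_2 => if r == 0 then x else y); split=> //.
  by move=> r; case: ifP => _; split.
move=> z [_ iz].
apply: (@sub_orthogonal _ 2 1 _ (\matrix_(t < 1) (e i).1)) => //.
- have -> : \matrix_(t < 1) (e i).1 = (e i).1.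
    by apply/matrixP => s t; rewrite !mxE ord1.
  exact/row_free1/normal_neq0.
- apply: mul_tr_rows => s t; rewrite dotC dotBr ia.2.
  by case: ifP => _; rewrite ?ix.2 ?iy.2 subrr.
- have -> : z - a = \matrix_(t < 1) (z - a).
    by apply/matrixP => s t; rewrite !mxE ord1.
  by apply: mul_tr_rows => s t; rewrite dotC dotBr ia.2 iz.2 subrr.
Qed.

Lemma edge_dim i j : adj i j -> affine_dim (family_edge i j) 1.
Proof.
move=> aij; have [a [x [ax Ea Ex]]] := edge_points aij.
have free : row_free (\matrix_(r < 1) (x - a)).
  have -> : \matrix_(t < 1) (x - a) = x - a.
    by apply/matrixP => s t; rewrite !mxE ord1.
  by apply: row_free1; rewrite subr_eq0 eq_sym.
exists a, (fun=> x); split=> // z Ez.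
have [[_ [_ ia]] [_ [_ ja]]] := Ea.
have orth y : family_edge i j y -> forall t : 'I_2,
    dot (y - a) (if t == 0 then (e i).1 else (e j).1) = 0.
  move=> [[_ [_ iy]] [_ [_ jy]]] t; rewrite dotC dotBr.
  by case: ifP => _; rewrite ?iy ?jy ?ia ?ja subrr.
apply: (@sub_orthogonal _ 1 2 _ _ _ free (normals_free aij ia ja)) => //.
- by apply: mul_tr_rows => s t; apply: orth.
- have -> : z - a = \matrix_(t < 1) (z - a).
    by apply/matrixP => s t; rewrite !mxE ord1.
  by apply: mul_tr_rows => s t; apply: orth.
Qed.

Lemma supports_e i : supports (e i) P.
Proof. by split=> [|x [Hx Px]]; [rewrite /spacelike e_norm | split]. Qed.

Lemma hplane_scale (l : R) f : 0 < l -> hplane (l *: f.1, l * f.2) = hplane f.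
Proof.
move=> l0; apply/seteqP; split=> x [Hx /=].
  by rewrite dotZl => /(mulfI (negbT (gt_eqF l0))).
by move=> fx; split=> //=; rewrite dotZl fx.
Qed.

Lemma active_dec i m : (forall k, dot (e k).1 m = (e k).2 -> k = i) \/
  exists2 j, i != j & dot (e j).1 m = (e j).2.
Proof.
have [|/forallNP h] := pselect (exists j, i != j /\ dot (e j).1 m = (e j).2).
  by move=> [j [ij jm]]; right; exists j.
left=> k km; apply/eqP; rewrite eq_sym; apply/negPn/negP => ik.
by have := h k; apply.
Qed.

(** If a second constraint were active at the centroid of three affinely
independent points of the face, it would be active at these points, which would
all lie on one edge.  This form of [is_faceP] also identifies the normal, as the
dihedral angle is defined from an arbitrary supporting half-space. *)
Lemma face_support f : supports f P -> is_face P (P `&` hplane f) ->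
  exists i, exists2 l : R, 0 < l & f = (l *: (e i).1, l * (e i).2).
Proof.
move=> sf [g [_ _ [a [x [fa fx free _]]]]].
(* m is the centroid of a, x 0 and x 1 *)
pose p := a + (1 / 2) *: (x 0 - a); pose m := p + (1 / 3) *: (x 1 - p).
have t2 : 0 < (1 / 2 : R) < 1 by apply/andP; split; lra.
have t3 : 0 < (1 / 3 : R) < 1 by apply/andP; split; lra.
have Pp : P p by apply: polyhedron_between => //; [exact: fa.1|exact: (fx 0).1].
have Pm : P m by apply: polyhedron_between => //; exact: (fx 1).1.
have fm : dot f.1 m = f.2.
  by rewrite !dotE fa.2.2 (fx 0).2.2 (fx 1).2.2; field.
have [i im] := support_active sf Pm fm.
have [only|[j nij jm]] := active_dec i m.
  by exists i; exact: support_single sf Pm fm im only.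
have act k : dot (e k).1 m = (e k).2 ->
    family_face k a /\ forall r, family_face k (x r).
  move=> km.
  have [kp k1] := active_between t3 (Pp.2 k) ((fx 1).1.2 k) km.
  have [ka k0] := active_between t2 (fa.1.2 k) ((fx 0).1.2 k) kp.
  split; first by split; [exact: fa.1 | split; [exact: fa.1.1|]].
  move=> r; split; first exact: (fx r).1.
  split; first exact: (fx r).1.1.
  case: (unliftP ord0 r) => [s ->|-> //]; rewrite ord1.
  by have -> : lift ord0 0 = 1 :> 'I_2 by apply/val_inj.
have [ia ix] := act i im; have [ja jx] := act j jm.
have aij := active_adj Pm.1 nij im jm.
have := @dim_le _ (family_edge i j) 2 a x 1%N.
by move=> /(_ (conj ia ja) (fun r => conj (ix r) (jx r)) free (edge_dim aij)).
Qed.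

Lemma is_faceP F : is_face P F <-> exists i, F = family_face i.
Proof.
split=> [[f [sf -> d]]|[i ->]].
  have [|i [l l0 ->]] := face_support sf; first by exists f.
  by exists i; rewrite hplane_scale.
by exists (e i); split; [exact: supports_e | | exact: face_dim].
Qed.

(** At the midpoint of two points of an edge exactly two constraints are active:
with a single one the supporting plane would cut out a whole face. *)
Lemma is_edgeP E : is_edge P E <-> exists i j, adj i j /\ E = family_edge i j.
Proof.
split=> [[f [sf -> d]]|[i [j [aij ->]]]]; last first.
  exists (e i + e j); split; last exact: edge_dim.
    split; last first.
      move=> x [Hx Px]; split=> //=; rewrite dotDl.
      by have := Px i; have := Px j => ? ?; lra.
    rewrite /spacelike lorentzDl !lorentzDr !e_norm (lorentzC (e j)) e_adj//.
    by lra.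
  apply/seteqP; split=> x.
    by move=> [[Px [Hx ix]] [_ [_ jx]]]; split=> //; split=> //=; rewrite dotDl ix jx.
  move=> [Px [Hx /=]]; rewrite dotDl => h.
  have := Px.2 i; have := Px.2 j => hj hi.
  by split; split=> //; split=> //; lra.
have [a [x [fa fx free span]]] := d.
pose m := a + (1 / 2) *: (x 0 - a).
have t2 : 0 < (1 / 2 : R) < 1 by apply/andP; split; lra.
have Pm : P m by apply: polyhedron_between => //; [exact: fa.1|exact: (fx 0).1].
have fm : dot f.1 m = f.2 by rewrite !dotE fa.2.2 (fx 0).2.2; field.
have [i im] := support_active sf Pm fm.
have [only|[j nij jm]] := active_dec i m.
  have [l l0 fE] := support_single sf Pm fm im only.
  move: d; rewrite fE hplane_scale// -/(family_face i) => d.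
  have [b [y [fb fy freey _]]] := face_dim i.
  by have := dim_le fb fy freey d.
have aij := active_adj Pm.1 nij im jm.
exists i, j; split=> //; apply/seteqP; split=> y.
  move=> fy.
  have act k : dot (e k).1 m = (e k).2 -> family_face k y.
    move=> km.
    have [ka k0] := active_between t2 (fa.1.2 k) ((fx 0).1.2 k) km.
    split; first exact: fy.1.
    split; first exact: fy.2.1.
    have /submxP[D] := span y fy; rewrite mulmx_sum_row big_ord1 rowK => h.
    have := congr1 (dot (e k).1) h; rewrite !dotE ka k0 subrr mulr0 => /eqP.
    by rewrite subr_eq0 => /eqP.
  by split; exact: act.
move=> [[Py [Hy iy]] [_ [_ jy]]]; split=> //; split=> //.
(* the edge can be prolonged beyond its point m, away from y *)
have [|t t0 /sf.2[_]] := @move_inside m (m - y) Pm.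
  move=> k km; have [->|->] := active_two Pm.1 nij im jm km.
    by rewrite dotBr im iy subrr.
  by rewrite dotBr jm jy subrr.
rewrite dotDr dotZr fm gerDl pmulr_rle0// dotBr fm subr_le0 => h.
by apply/eqP; rewrite eq_le h (sf.2 _ Py).2.
Qed.

Lemma face_other i j : i != j -> exists2 x, family_face i x & ~ family_face j x.
Proof.
move=> nij; have [k [kj aik]] := e_deg i j.
have [x [_ [_ [ix kx] _]]] := edge_points aik.
exists x => // jx.
have [ji|jk] := active_two ix.1.1 (adj_neq aik) ix.2.2 kx.2.2 jx.2.2.
  by rewrite ji eqxx in nij.
by rewrite jk eqxx in kj.
Qed.

Lemma family_face_inj : injective family_face.
Proof.
move=> i j ij; apply/eqP/negPn/negP => /face_other[x].
by rewrite ij.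
Qed.

Lemma edge_sub_face i j k : adj i j -> family_edge i j `<=` family_face k ->
  k = i \/ k = j.
Proof.
move=> aij sub; have [x [_ [_ [ix jx] _]]] := edge_points aij.
have kx := sub _ (conj ix jx).
exact: active_two ix.1.1 (adj_neq aij) ix.2.2 jx.2.2 kx.2.2.
Qed.

Lemma adjacent_facesP i j :
  adjacent_faces P (family_face i) (family_face j) <-> adj i j.
Proof.
split=> [[ne [E [/is_edgeP[k [l [akl ->]]] si sj]]]|aij].
  have nij : i != j by apply/eqP => ij; apply: ne; rewrite ij.
  have [iE|iE] := edge_sub_face akl si; have [jE|jE] := edge_sub_face akl sj;
    move: nij; rewrite iE jE ?eqxx// adj_sym//.
split; first by move/family_face_inj => ij; move: (adj_neq aij); rewrite ij eqxx.
exists (family_edge i j); split; first by apply/is_edgeP; exists i, j.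
  exact: subIsetl.
exact: subIsetr.
Qed.

(** The edges of a face correspond to its neighbours, and two neighbours cannot
share an edge of it because no point lies on three planes. *)
Lemma face_gon i : is_gon P (family_face i) #|[set j | adj i j]%SET|.
Proof.
rewrite /is_gon; have -> : [set E | is_edge P E /\ E `<=` family_face i]
    = family_edge i @` [set` [set j | adj i j]%SET].
  apply/seteqP; split=> [E [/is_edgeP[k [l [akl ->]]] s]|E [j /=]].
    have [iE|iE] := edge_sub_face akl s; subst i.
      by exists l => //=; rewrite inE.
    by exists k => /=; [rewrite inE adj_sym | rewrite /family_edge setIC].
  rewrite inE => aij <-; split; last exact: subIsetl.
  by apply/is_edgeP; exists i, j.
apply: card_eq_trans (inj_card_eq _) _.
  move=> j k; rewrite !inE /= !inE => aij aik E.
  have : family_edge i j `<=` family_face k by rewrite E; exact: subIsetr.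
  by move=> /(edge_sub_face aij)[ki|//]; move: (adj_neq aik); rewrite ki eqxx.
exact: card_set_fin.
Qed.

Lemma family_convex : convex_polyhedron P.
Proof.
split.
  exists [seq e i | i <- enum I]; split.
    by move=> _ /mapP[i _ ->]; rewrite /spacelike e_norm.
  apply/seteqP; split=> x.
    by move=> [Hx Px]; split=> // _ /= /mapP[i _ ->]; split.
  move=> [Hx Px]; split=> // i.
  by have [] := Px (e i) (map_f _ (mem_enum _ i)).
exists 0; rewrite /interior /=.
have H0 : nbhs (0 : 'rV[R]_3) (@H3 R).
  have op : open (@H3 R).
    apply: (@open_comp _ _ (fun x : 'rV[R]_3 => dot x x) [set y | y < 1]); last first.
      exact: open_lt.
    by move=> x _; exact: sqnorm_continuous.
  by apply: open_nbhs_nbhs; split=> //; rewrite /H3/= dot0r.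
have Hi : \forall x \near (0 : 'rV[R]_3), forall i, dot (e i).1 x <= (e i).2.
  have FF := @nbhs_filter _ (0 : 'rV[R]_3); apply: (filter_forall FF) => i.
  have op : open (dot (e i).1 @^-1` [set y | y < (e i).2]).
    apply: open_comp; last exact: open_lt.
    by move=> x _; exact: dot_continuous.
  have : nbhs (0 : 'rV[R]_3) (dot (e i).1 @^-1` [set y | y < (e i).2]).
    by apply: open_nbhs_nbhs; split=> //=; rewrite dot0r.
  by apply: filterS => x /ltW.
by near=> x; split; near: x.
Unshelve. all: by end_near. Qed.

Lemma dihedral_scale (l l' : R) f g : 0 < l -> 0 < l' ->
  dihedral_angle (l *: f.1, l * f.2) (l' *: g.1, l' * g.2) = dihedral_angle f g.
Proof.
move=> l0 l'0; rewrite /dihedral_angle.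
have sc a b h h' : lorentz (a *: h.1, a * h.2) (b *: h'.1, b * h'.2)
    = a * b * lorentz h h' :> R by rewrite /lorentz /= !dotE; ring.
have sq (a b : R) : 0 < a -> Num.sqrt (a * a * b) = a * Num.sqrt b.
  by move=> a0; rewrite sqrtrM ?mulr_ge0 ?ltW// -expr2 sqrtr_sqr gtr0_norm.
rewrite !sc !sq//.
rewrite mulrACA -mulf_div divff ?mul1r//.
by rewrite mulf_neq0// gt_eqF.
Qed.

Lemma family_equiangular :
  (hyp_volume P < +oo)%E -> equiangular P (pi / 3).
Proof.
move=> vol; split; first by split=> //; exact: family_convex.
move=> f g sf sg /(face_support sf)[i [l l0 ->]] /(face_support sg)[j [l' l'0 ->]].
rewrite !hplane_scale// => /adjacent_facesP aij.
rewrite dihedral_scale// /dihedral_angle !e_norm e_adj// sqrtr1 mulr1 divr1.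
have pi0 := pi_gt0 R.
rewrite acosN; last by apply/andP; split; lra.
have -> : acos (1 / 2) = pi / 3 :> R.
  by rewrite -cos_pi3 cosK// in_itv/=; apply/andP; split; lra.
by rewrite opprB addrCA subrr addr0.
Qed.

Lemma family_face_count : [set F | is_face P F] #= `I_#|I|.
Proof.
have -> : [set F | is_face P F] = family_face @` [set: I].
  apply/seteqP; split=> [F /is_faceP[i ->]|_ [i _ <-]]; first by exists i.
  by apply/is_faceP; exists i.
apply: card_eq_trans (inj_card_eq _) _.
  by move=> i j _ _; exact: family_face_inj.
rewrite -cardsT.
suff -> : [set: I] = [set` [set: I]%SET] by exact: card_set_fin.
by apply/seteqP; split=> i //=; rewrite inE.
Qed.

(** The open segment from [w] to any point of the face lies in the face. *)
Lemma ideal_closure i w : dot w w = 1 ->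
  (forall k, dot (e k).1 w <= (e k).2) -> dot (e i).1 w = (e i).2 ->
  closure (family_face i) w.
Proof.
move=> w1 Pw iw; have [y [_ [[[Hy Py] [_ iy]] _ _ _]]] := face_dim i.
have seg (t : R) : 0 < t < 1 -> family_face i (w + t *: (y - w)).
  move=> t01; have Ht : H3 (w + t *: (y - w)) by apply: H3_between; rewrite ?w1.
  split; last by split=> //; rewrite !dotE iw iy; ring.
  by split=> // k; exact: dot_between_le.
have cv : (fun t : R => w + t *: (y - w)) t @[t --> 0^'+] --> w.
  have -> : nbhs w = nbhs (w + (0 : R) *: (y - w)) by rewrite scale0r addr0.
  apply: cvg_at_right_filter; apply: cvgD; first exact: cvg_cst.
  by apply: cvgZl.
move=> B /cv /= nB.
have : \forall t \near (0 : R)^'+, B (w + t *: (y - w)) /\ 0 < t < 1.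
  near=> t; split; first by near: t; exact: nB.
  apply/andP; split; near: t; [exact: nbhs_right_gt | exact: nbhs_right_lt].
by move=> /filter_ex[t [Bt /seg Ft]]; exists (w + t *: (y - w)).
Unshelve. all: by end_near. Qed.

End Family.

(** * Finiteness of the volume *)

Section Volume.
Variable R : realType.
Implicit Types (v x : 'rV[R]_3) (p : R * R * R).

Import HBNNSimple.

(** By definition, the integral of a nonnegative function is a supremum over the
simple functions below it. *)
Lemma ge0_integral_mono d (T : measurableType d)
    (mu : {measure set T -> \bar R}) (f g : T -> \bar R) :
  (forall t, 0 <= f t)%E -> (forall t, f t <= g t)%E ->
  (\int[mu]_t f t <= \int[mu]_t g t)%E.
Proof.
move=> f0 fg; rewrite !ge0_integralTE//; last first.
  by move=> t; exact: le_trans (fg t).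
apply: ereal_sup_le => _ /= [h hf <-].
by exists h => // t; exact: le_trans (fg t).
Qed.

Local Notation R3 :=
  (measurableTypeR R * measurableTypeR R * measurableTypeR R)%type.
Local Notation mu3 :=
  ((lebesgue_measure \x lebesgue_measure) \x lebesgue_measure)%E.

Definition cube (v : 'rV[R]_3) (r : R) : set R3 :=
  (`[v 0 0 - r, v 0 0 + r] `*` `[v 0 1 - r, v 0 1 + r])
  `*` `[v 0 2%:R - r, v 0 2%:R + r].

Lemma measurable_cube v r : measurable (cube v r).
Proof. by apply: measurableX; [apply: measurableX|]; exact: measurable_itv. Qed.

Lemma cube_measure v r : 0 < r -> mu3 (cube v r) = ((2 * r) ^+ 3)%:E.
Proof.
move=> r0; rewrite /cube.
have side (a : R) : lebesgue_measure (`[a - r, a + r] : set R) = (2 * r)%:E.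
  rewrite lebesgue_measure_itv /= lte_fin ifT; last by lra.
  by rewrite -EFinB; congr (_%:E); ring.
rewrite product_measure1E//=; last by apply: measurableX.
by rewrite product_measure1E//= !side -!EFinM; congr (_%:E); ring.
Qed.

Lemma dyadic_shell (D : R) : 0 < D <= 1 ->
  exists k : nat, 2 ^- k.+1 < D <= 2 ^- k.
Proof.
move=> /andP[D0 D1].
have ex : exists k : nat, 2 ^- k.+1 < D.
  have : \forall k \near \oo, (1 / 2 : R) ^+ k < D.
    apply: cvgr_lt D0; apply: cvg_expr.
    by rewrite ger0_norm; lra.
  case=> N _ /(_ N.+1 (leqnSn _)) h; exists N.
  by move: h; rewrite /= div1r exprVn.
case: (ex_minnP ex) => k hk hmin; exists k; rewrite hk /=.
case: k hk hmin => [|k] hk hmin; first by rewrite expr0 invr1.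
rewrite leNgt; apply/negP => /hmin; by rewrite ltnn.
Qed.

(** Where [2 ^- k.+1 < 1 - dot x x <= 2 ^- k], the density is at most
[4 ^+ k.+1] and [x] is in the cube of half-side [C * 2 ^- k] around some point of
[V].  The integral is thus bounded by a sum over [V] of geometric series. *)
Lemma finite_hyp_volume (P : set 'rV[R]_3) (V : seq 'rV[R]_3) (C : R) :
  0 < C -> P `<=` @H3 R ->
  (forall x, P x -> exists2 v, v \in V &
     forall l, `|x 0 l - v 0 l| <= C * (1 - dot x x)) ->
  (hyp_volume P < +oo)%E.
Proof.
move=> C0 PH near_V; rewrite /hyp_volume integral_mkcond.
pose r k : R := C * 2 ^- k.
have r0 k : 0 < r k by rewrite mulr_gt0// invr_gt0 exprn_gt0.
pose c k : R := 4 ^+ k.+1.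
have c0 k : 0 <= c k by rewrite exprn_ge0.
pose h v k (p : R3) : \bar R := (c k * \1_(cube v (r k)) p)%:E.
have h0 v k p : (0 <= h v k p)%E by rewrite lee_fin mulr_ge0// indicE.
have mh v k : measurable_fun setT (h v k).
  apply/measurable_EFinP; apply: measurable_funM => //.
  apply: measurable_indic; exact: measurable_cube.
pose H v (p : R3) := (\sum_(0 <= k <oo) h v k p)%E.
have H0 v p : (0 <= H v p)%E by apply: nneseries_ge0.
have mH v : measurable_fun setT (H v).
  by apply: ge0_emeasurable_sum => //.
have int_h v k : (\int[mu3]_p h v k p)%E = (64 * C ^+ 3 / (2 ^ k.+1)%:R)%:E.
  transitivity ((c k)%:E * \int[mu3]_p (\1_(cube v (r k)) p)%:E)%E.
    rewrite -ge0_integralZl_EFin//.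
    by apply/measurable_EFinP; apply: measurable_indic; exact: measurable_cube.
  rewrite integral_indic//; last exact: measurable_cube.
  rewrite setIT; transitivity ((c k)%:E * ((2 * r k) ^+ 3)%:E)%E.
    by congr (_ * _)%E; exact: cube_measure.
  rewrite -EFinM; congr (_%:E).
  have p0 : (2 : R) ^+ k != 0 by rewrite expf_neq0.
  rewrite /c /r natrX !exprS (_ : (4 : R) = 2 * 2); last by ring.
  by rewrite exprMn expr0; field.
apply: (@le_lt_trans _ _ (\int[mu3]_p \sum_(v <- V) H v p)%E).
  apply: ge0_integral_mono => p.
    by apply: erestrict_ge0 => q _; rewrite lee_fin invr_ge0 sqr_ge0.
  rewrite patchE; case: ifPn => [|_]; last by apply: sume_ge0.
  rewrite inE /= => Pp.
  have [v Vv near_v] := near_V _ Pp.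
  apply: (@le_trans _ _ (H v p)); last first.
    by rewrite (big_rem v)//= leeDl// sume_ge0.
  set D := 1 - _.
  have D01 : 0 < D <= 1.
    have := dot_ge0 (row3 p); have := PH _ Pp; rewrite /H3/= /D => ? ?.
    by apply/andP; split; lra.
  have [k /andP[k1 k2]] := dyadic_shell D01.
  have D0 : 0 < D by case/andP: D01.
  apply: (@le_trans _ _ (h v k p)).
    rewrite /h indicE (_ : p \in _) ?mulr1 ?lee_fin.
      rewrite /c (_ : (4 : R) = 2 ^+ 2); last by ring.
      rewrite -exprM mulnC exprM -[leRHS]invrK lef_pV2 ?posrE.
      - by rewrite -exprVn ler_pXn2r ?nnegrE ?ltW// invr_gt0 exprn_gt0.
      - by rewrite exprn_gt0.
      - by rewrite invr_gt0 !exprn_gt0.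
    rewrite inE; have lr l : `|row3 p 0 l - v 0 l| <= r k.
      by apply: (le_trans (near_v l)); rewrite /r ler_pM2l.
    have := lr 0; have := lr 1; have := lr 2%:R; rewrite !mxE /= !ler_norml.
    move=> /andP[? ?] /andP[? ?] /andP[? ?].
    by rewrite /cube; split=> /=; [split=> /=|]; rewrite in_itv/=; apply/andP; split; lra.
  by rewrite /H (nneseriesD1 (n := k))// leeDl// nneseries_ge0.
rewrite ge0_integral_sum//.
rewrite big_seq; apply: lte_sum_pinfty => v _.
rewrite integral_nneseries//.
apply: (@le_lt_trans _ _ (64 * C ^+ 3)%:E); last exact: ltry.
rewrite (eq_eseriesr (fun k _ => int_h v k)).
apply: epsilon_trick0.
by rewrite mulr_ge0// exprn_ge0// ltW.
Qed.

End Volume.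

(** * Sums over three indices *)

Lemma big3 (T : Type) (idx : T) (op : Monoid.law idx) (F : 'I_3 -> T) :
  \big[op/idx]_i F i = op (op (F 0) (F 1)) (F 2%:R).
Proof.
rewrite !big_ord_recr big_ord0 /= Monoid.mul1m.
by congr (op (op (F _) (F _)) (F _)); apply/val_inj.
Qed.

Lemma ord3_ind (P : 'I_3 -> Prop) : P 0 -> P 1 -> P 2%:R -> forall i, P i.
Proof.
move=> P0 P1 P2 [[|[|[|//]]] i3].
- by rewrite (_ : Ordinal i3 = 0)//; apply/val_inj.
- by rewrite (_ : Ordinal i3 = 1)//; apply/val_inj.
- by rewrite (_ : Ordinal i3 = 2%:R)//; apply/val_inj.
Qed.

(** Lets an argument single out one index without treating three cases. *)
Lemma ord3_split (c : 'I_3) : exists i j : 'I_3,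
  [/\ c != i, c != j, i != j, (forall k, [\/ k = c, k = i | k = j]) &
      forall (T : Type) (idx : T) (op : Monoid.com_law idx) (F : 'I_3 -> T),
        \big[op/idx]_k F k = op (op (F c) (F i)) (F j)].
Proof.
have cases (k : 'I_3) : [\/ k = 0, k = 1 | k = 2%:R].
  elim/ord3_ind : k; by [constructor 1|constructor 2|constructor 3].
elim/ord3_ind : c; [exists 1, 2%:R|exists 0, 2%:R|exists 0, 1]; split=> //;
  try (by move=> k; case: (cases k) => ->;
       by [constructor 1|constructor 2|constructor 3]);
  move=> T idx op F; transitivity (op (op (F 0) (F 1)) (F 2%:R)) => //;
  try exact: big3.
- by rewrite (Monoid.mulmC op (F 0)).
- by rewrite Monoid.mulmC Monoid.mulmA.
Qed.

(** * Planes and ideal points in barycentric coordinates *)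

Section Geometry.
Variables (R : realType) (m : nat).
Local Notation M := (m%:R : R).
Local Notation N := (M + 1).
Implicit Types (x : 'rV[R]_3) (a p q : 'I_3 -> R) (k l : 'I_3).

Lemma dot3 x y : dot x y = x 0 0 * y 0 0 + x 0 1 * y 0 1 + x 0 2%:R * y 0 2%:R.
Proof. by rewrite /dot mxE big3 /= !mxE. Qed.

Definition sqrt3 : R := Num.sqrt 3.

Lemma sqrt3_sqr : sqrt3 ^+ 2 = 3.
Proof. by rewrite sqr_sqrtr. Qed.

(** The vectors [(ox k, oy k)] are unit vectors at mutual angles 2 pi / 3, the
inward normals of the sides of the triangle. *)
Definition ox k : R := [:: 1; - (1 / 2); - (1 / 2)]`_k.
Definition oy k : R := [:: 0; sqrt3 / 2; - (sqrt3 / 2)]`_k.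

(** The points [x] of the Klein model are handled through homogeneous coordinates
in which [height x] plays the part of 1: on the closed ball it vanishes at the
apex only, and dividing by it sends the apex to infinity. *)
Definition height x : R := 1 - x 0 2%:R.
(** Homogeneous barycentric coordinates of the vertical projection of [x] to the
plane that contains the triangle, with sum [N * height x]. *)
Definition bary k x : R := N / 3 * height x + ox k * x 0 0 + oy k * x 0 1.

Definition side_plane k : 'rV[R]_3 * R :=
  (row3 (- ox k, - oy k, N / 3), N / 3).

(** Half of the constant term of the equation [\sum_k (a k - p k) ^+ 2 - 1 = 0] of
the circle, in Cartesian coordinates centred at the centre of the triangle. *)
Definition kappa p : R := (\sum_k p k ^+ 2) / 2 - M ^+ 2 / 6 - 1 / 3.

Definition circle_plane p : 'rV[R]_3 * R :=
  (row3 (\sum_k p k * ox k, \sum_k p k * oy k, kappa p - 3 / 4),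
   kappa p + 3 / 4).

Lemma side_planeE k x :
  (side_plane k).2 - dot (side_plane k).1 x = bary k x.
Proof. by rewrite dot3 /bary /height !mxE /=; ring. Qed.

Lemma bary_sum x : \sum_k bary k x = N * height x.
Proof. by rewrite big3 /bary /ox /oy /=; field. Qed.

(** The polynomial defining the hemisphere of [p]: its last term vanishes at ideal
points, where there remains the equation of the circle. *)
Lemma circle_planeE p x : \sum_k p k = M ->
  2 * height x * ((circle_plane p).2 - dot (circle_plane p).1 x) =
  \sum_k (bary k x - p k * height x) ^+ 2 - height x ^+ 2
  + 3 / 2 * (1 - dot x x).
Proof.
rewrite !dot3 !mxE /= /kappa /bary /height !big3 /ox /oy /= => pM.
rewrite -pM.
have := sqrt3_sqr; move: sqrt3 => s s2.
pose kap := (p 0 ^+ 2 + p 1 ^+ 2 + p 2%:R ^+ 2) / 2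
  - (p 0 + p 1 + p 2%:R) ^+ 2 / 6 - 1 / 3.
transitivity (2 * (1 - x 0 2%:R) * (kap + 3 / 4 -
  ((p 0 - p 1 / 2 - p 2%:R / 2) * x 0 0 + (p 1 - p 2%:R) * s / 2 * x 0 1 +
   (kap - 3 / 4) * x 0 2%:R))); first by rewrite /kap; field.
have -> : x 0 1 * x 0 1 = s ^+ 2 * x 0 1 ^+ 2 / 3 by rewrite s2; field.
by rewrite /kap; field.
Qed.

Lemma side_side k l : lorentz (side_plane k) (side_plane l) =
  if k == l then 1 else - (1 / 2).
Proof.
rewrite /lorentz dot3 !mxE /= /ox /oy.
have := sqrt3_sqr; move: sqrt3 => s s2.
have e1 : s / 2 * (s / 2) = 3 / 4 by rewrite -s2; field.
by elim/ord3_ind : k; elim/ord3_ind : l => /=; rewrite ?mulrNN ?mulrN ?mulNr ?e1; field.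
Qed.

Lemma side_circle k p : \sum_k p k = M ->
  lorentz (side_plane k) (circle_plane p) = - (3 / 2 * p k) - 1 / 2.
Proof.
rewrite /lorentz dot3 !mxE /= !big3 /= /ox /oy => pM.
rewrite -pM; have := sqrt3_sqr; move: sqrt3 => s s2.
have e1 : s / 2 * (s / 2) = 3 / 4 by rewrite -s2; field.
elim/ord3_ind : k => /=.
- by field.
- transitivity (- (p 1 - p 2%:R) * (s / 2 * (s / 2))
    + 1 / 2 * (p 0 - p 1 / 2 - p 2%:R / 2)
    - 3 / 2 * ((p 0 + p 1 + p 2%:R + 1) / 3)).
    by field.
  by rewrite e1; field.
- transitivity ((p 1 - p 2%:R) * (s / 2 * (s / 2))
    + 1 / 2 * (p 0 - p 1 / 2 - p 2%:R / 2)
    - 3 / 2 * ((p 0 + p 1 + p 2%:R + 1) / 3)).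
    by field.
  by rewrite e1; field.
Qed.

(** Equals -1/2 when [p] and [q] differ by one unit moved between two coordinates;
their squared distance is then 2. *)
Lemma circle_circle p q : \sum_k p k = M -> \sum_k q k = M ->
  lorentz (circle_plane p) (circle_plane q)
  = 1 - 3 / 4 * \sum_k (p k - q k) ^+ 2.
Proof.
rewrite /lorentz dot3 !mxE /= /kappa !big3 /= /ox /oy /= => pM qM.
have pE : p 2%:R = M - p 0 - p 1 by rewrite -pM; ring.
have qE : q 2%:R = M - q 0 - q 1 by rewrite -qM; ring.
rewrite pE qE; have := sqrt3_sqr; move: sqrt3 => s s2.
have e1 : s / 2 * (s / 2) = 3 / 4 by rewrite -s2; field.
transitivity ((p 0 - (M - p 0) / 2) * (q 0 - (M - q 0) / 2) +
  (2 * p 1 - M + p 0) * (2 * q 1 - M + q 0) * (s / 2 * (s / 2)) - 3 / 2 *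
  ((p 0 ^+ 2 + p 1 ^+ 2 + (M - p 0 - p 1) ^+ 2) / 2
  + (q 0 ^+ 2 + q 1 ^+ 2 + (M - q 0 - q 1) ^+ 2) / 2 - M ^+ 2 / 3 - 2 / 3)).
  by field.
by rewrite e1; field.
Qed.

(** Cartesian coordinates of the point with barycentric coordinates [a]. *)
Definition zx a : R := 2 / 3 * \sum_k a k * ox k.
Definition zy a : R := 2 / 3 * \sum_k a k * oy k.
Definition zz a : R := zx a ^+ 2 + zy a ^+ 2.

(** Inverse stereographic projection from the apex. *)
Definition ideal_point a : 'rV[R]_3 :=
  row3 (2 * zx a / (zz a + 1), 2 * zy a / (zz a + 1), (zz a - 1) / (zz a + 1)).

Definition apex : 'rV[R]_3 := row3 (0, 0, 1).

Lemma zz1_gt0 a : 0 < zz a + 1.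
Proof. by rewrite ltr_wpDl// addr_ge0 ?sqr_ge0. Qed.

Lemma ideal_point_norm a : dot (ideal_point a) (ideal_point a) = 1.
Proof.
have := zz1_gt0 a; rewrite dot3 !mxE /= /zz => /gt_eqF/negbT z0.
by field.
Qed.

Lemma ideal_point_height a : height (ideal_point a) = 2 / (zz a + 1).
Proof.
have := zz1_gt0 a; rewrite /height !mxE /= => /gt_eqF/negbT z0.
by field.
Qed.

Lemma ideal_point_height_gt0 a : 0 < height (ideal_point a).
Proof. by rewrite ideal_point_height divr_gt0// zz1_gt0. Qed.

Lemma z_bary a k : \sum_k a k = N -> N / 3 + ox k * zx a + oy k * zy a = a k.
Proof.
rewrite /zx /zy !big3 /= /ox /oy => aN.
have aE : a 2%:R = N - a 0 - a 1 by rewrite -aN; ring.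
have := sqrt3_sqr; move: sqrt3 => s s2.
have e1 : s / 2 * (s / 2) = 3 / 4 by rewrite -s2; field.
elim/ord3_ind : k => /=; rewrite aE.
- by field.
- transitivity (N / 3 - 1 / 3 * (a 0 - (N - a 0) / 2)
    + 2 / 3 * (a 1 - (N - a 0 - a 1)) * (s / 2 * (s / 2))); first by field.
  by rewrite e1; field.
- transitivity (N / 3 - 1 / 3 * (a 0 - (N - a 0) / 2)
    - 2 / 3 * (a 1 - (N - a 0 - a 1)) * (s / 2 * (s / 2))); first by field.
  by rewrite e1; field.
Qed.

Lemma bary_ideal_point a k : \sum_k a k = N ->
  bary k (ideal_point a) = a k * height (ideal_point a).
Proof.
move=> aN; rewrite /bary -(z_bary k aN) ideal_point_height !mxE /=.
have := zz1_gt0 a => /gt_eqF/negbT z0.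
by field.
Qed.

Lemma side_ideal_point a k : \sum_k a k = N -> 0 <= a k ->
  dot (side_plane k).1 (ideal_point a) <= (side_plane k).2.
Proof.
move=> aN a0; rewrite -subr_ge0 side_planeE bary_ideal_point//.
by rewrite mulr_ge0// ltW// ideal_point_height_gt0.
Qed.

Lemma side_ideal_point_eq a k : \sum_k a k = N -> a k = 0 ->
  dot (side_plane k).1 (ideal_point a) = (side_plane k).2.
Proof.
move=> aN a0; apply/esym/eqP; rewrite -subr_eq0 side_planeE bary_ideal_point//.
by rewrite a0 mul0r.
Qed.

Lemma circle_ideal_point a p : \sum_k a k = N -> \sum_k p k = M ->
  2 * ((circle_plane p).2 - dot (circle_plane p).1 (ideal_point a))
  = height (ideal_point a) * (\sum_k (a k - p k) ^+ 2 - 1).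
Proof.
move=> aN pM; have h0 := ideal_point_height_gt0 a.
apply: (mulfI (negbT (gt_eqF h0))).
rewrite [LHS]mulrCA mulrA circle_planeE// ideal_point_norm !big3 /=.
by rewrite !bary_ideal_point//; ring.
Qed.

Lemma circle_ideal_point_le a p : \sum_k a k = N -> \sum_k p k = M ->
  1 <= \sum_k (a k - p k) ^+ 2 ->
  dot (circle_plane p).1 (ideal_point a) <= (circle_plane p).2.
Proof.
move=> aN pM h; have h0 := ideal_point_height_gt0 a.
have h1 : 0 <= height (ideal_point a) * (\sum_k (a k - p k) ^+ 2 - 1).
  by apply: mulr_ge0; [exact: ltW | rewrite subr_ge0].
by move: h1; rewrite -(circle_ideal_point aN pM) => h1; lra.
Qed.

Lemma circle_ideal_point_eq a p : \sum_k a k = N -> \sum_k p k = M ->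
  \sum_k (a k - p k) ^+ 2 = 1 ->
  dot (circle_plane p).1 (ideal_point a) = (circle_plane p).2.
Proof.
move=> aN pM h; have := circle_ideal_point aN pM.
by rewrite h subrr mulr0 => ?; lra.
Qed.

Lemma ideal_point_inj a b k : \sum_k a k = N -> \sum_k b k = N ->
  ideal_point a = ideal_point b -> a k = b k.
Proof.
move=> aN bN ab; have h0 := ideal_point_height_gt0 b.
apply: (mulIf (negbT (gt_eqF h0))).
by rewrite -bary_ideal_point// -ab bary_ideal_point.
Qed.

Lemma ideal_point_neq_apex a : ideal_point a != apex.
Proof.
apply/eqP => ea; have := ideal_point_height_gt0 a.
by rewrite ea /height mxE /= subrr ltxx.
Qed.

Lemma apex_norm : dot apex apex = 1.
Proof. by rewrite dot3 !mxE /=; ring. Qed.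

Lemma side_apex k : dot (side_plane k).1 apex = (side_plane k).2.
Proof. by rewrite dot3 !mxE /=; ring. Qed.

Lemma circle_apex p : dot (circle_plane p).1 apex < (circle_plane p).2.
Proof. by rewrite dot3 !mxE /=; lra. Qed.

Lemma side_origin k : 0 < (side_plane k).2.
Proof. by rewrite /= divr_gt0// ltr_wpDl. Qed.

Lemma circle_origin p : \sum_k p k = M -> 0 < (circle_plane p).2.
Proof.
move=> pM; rewrite /= /kappa -pM !big3 /=.
have := sqr_ge0 (p 0 - p 1); have := sqr_ge0 (p 1 - p 2%:R).
have := sqr_ge0 (p 0 - p 2%:R) => h1 h2 h3.
have : 0 <= ((p 0 - p 1) ^+ 2 + (p 1 - p 2%:R) ^+ 2 + (p 0 - p 2%:R) ^+ 2) / 6.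
  by rewrite divr_ge0// !addr_ge0.
have -> : ((p 0 - p 1) ^+ 2 + (p 1 - p 2%:R) ^+ 2 + (p 0 - p 2%:R) ^+ 2) / 6
 = (p 0 ^+ 2 + p 1 ^+ 2 + p 2%:R ^+ 2) / 2 - (p 0 + p 1 + p 2%:R) ^+ 2 / 6.
  by field.
by move=> ?; lra.
Qed.

End Geometry.

(** * Distance to the ideal vertices *)

Section CuspBound.
Variables (R : realType) (m : nat).
Local Notation M := (m%:R : R).
Local Notation N := (M + 1).
Implicit Types (x : 'rV[R]_3) (a b : 'I_3 -> R) (k l : 'I_3).

(** For a point with barycentric coordinates [p], [q], [r] in a unit triangle of
opposite orientation, [2 * (p * q - r ^+ 2)] is the depth inside the circle of
the triangle across the side where [r] vanishes.  When [r] is the smallest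
coordinate, this depth vanishes only at two corners and at the centre; here it
is compared with the distance to a corner, and in the next lemma to the centre. *)
Lemma down_triangle_vertex (p q r : R) :
  0 <= r -> r <= p -> r <= q -> p + q + r = 1 -> 1 / 2 <= p ->
  1 - p <= 8 * (p * q - r ^+ 2).
Proof.
move=> r0 rp rq s1 p2.
have h1 : 0 <= r * (q - r) by rewrite mulr_ge0// subr_ge0.
have h2 : (1 - p) / 2 * (1 / 4) <= q * (p - r) by apply: ler_pM; lra.
by lra.
Qed.

Lemma down_triangle_center (p q r : R) :
  0 <= r -> r <= p -> r <= q -> p + q + r = 1 -> p <= 1 / 2 ->
  p - r <= 8 * (p * q - r ^+ 2).
Proof.
move=> r0 rp rq s1 p2.
have h1 : 0 <= r * (q - r) by rewrite mulr_ge0// subr_ge0.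
have h2 : 1 / 6 * (p - r) <= q * (p - r) by apply: ler_pM; lra.
by lra.
Qed.

(** The circles cover the triangle, and the depth of a point inside the best circle
dominates its distance to some ideal vertex.  In a triangle of the orientation
of the large one, with coordinates [x k] of sum 1, the depth in its own circle is
[1 - \sum_k x k ^+ 2 >= 1 - x c] for the largest coordinate [x c].  In the other
triangles the circle is the one across the nearest side. *)
Lemma nearest_vertex a : (forall k, 0 <= a k) -> \sum_k a k = N ->
  exists (p : 'I_3 -> nat) (f : 'I_3 -> nat) (c : R),
  [/\ (\sum_k p k = m)%N, (forall k, (f k <= m.+1)%N), c \in [:: 0; 2 / 3],
      \sum_k ((f k)%:R + c) = N &
      forall k, `|a k - ((f k)%:R + c)|
        <= 4 * (1 - \sum_l (a l - (p l)%:R) ^+ 2)].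
Proof.
move=> a0 aN.
pose f k := Num.truncn (a k).
pose x k := a k - (f k)%:R.
have fa k : (f k)%:R <= a k < (f k).+1%:R by exact: truncn_itv.
have x0 k : 0 <= x k by rewrite subr_ge0; case/andP: (fa k).
have x1 k : x k < 1 by have /andP[_] := fa k; rewrite -natr1 /x => ?; lra.
have aE k : a k = (f k)%:R + x k by rewrite /x addrC subrK.
have sx : \sum_k x k = N - (\sum_k f k)%:R.
  by rewrite sumrB aN natr_sum.
have [c cmax] : exists c, forall k, x k <= x c.
  have [c _ cmax] := @Order.TotalTheory.arg_maxP _ _ _ (0 : 'I_3) xpredT x isT.
  by exists c => k; exact: cmax.
have sx0 : 0 <= \sum_k x k by exact: sumr_ge0.
have sx3 : \sum_k x k < 3.
  by rewrite big3 /=; have := x1 0; have := x1 1; have := x1 2%:R => ? ? ?; lra.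
have natM : (m.+1)%:R = N by rewrite -natr1.
have le1 : (\sum_k f k <= m.+1)%N by rewrite -(ler_nat R) natM; lra.
have le2 : (m.+1 < \sum_k f k + 3)%N by rewrite -(ltr_nat R) natrD natM; lra.
have fle k : (f k <= \sum_k f k)%N by rewrite (bigD1 k)//= leq_addr.
(* node, triangle of the same orientation, or of the opposite one *)
have [s0|[s1|s2]] : (\sum_k f k = m.+1 \/ \sum_k f k = m \/ (\sum_k f k).+1 = m)%N by lia.
- have xz : forall k, x k = 0.
    move: sx; rewrite s0 natM subrr big3 /= => sx k.
    have := x0 0; have := x0 1; have := x0 2%:R.
    by elim/ord3_ind : k => ? ? ?; lra.
  have [d fd] : exists d, (0 < f d)%N.
    apply: contrapT => /forallNP h; move: s0; rewrite big3 /=.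
    by have := h 0; have := h 1; have := h 2%:R; lia.
  exists (fun k => f k - (k == d))%N, f, 0; split.
  + move: s0; rewrite !big3 /=.
    by elim/ord3_ind : d fd => /= fd; lia.
  + by move=> k; apply: leq_trans (fle k) _; rewrite s0.
  + by rewrite inE eqxx.
  + by rewrite big_split /= sumr_const mul0rn addr0 -natr_sum s0.
  + move=> k; rewrite aE xz !addr0 subrr normr0.
    have -> : \sum_l (a l - (f l - (l == d))%:R) ^+ 2 = \sum_l (l == d)%:R :> R.
      apply: eq_bigr => l _; rewrite aE xz addr0.
      have [->|_] := eqVneq l d; last by rewrite subn0 subrr expr0n.
      by rewrite natrB// opprB addrCA subrr addr0 expr1n.
    by rewrite -natr_sum (bigD1 d)//= eqxx big1 ?subrr ?mulr0// => l /negbTE ->.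
- have sx1 : \sum_k x k = 1 by rewrite sx s1; ring.
  have S : \sum_k x k ^+ 2 <= x c.
    rewrite -[leRHS]mul1r -sx1 mulr_suml; apply: ler_sum => k _.
    by rewrite expr2 ler_wpM2l.
  exists f, (fun k => f k + (k == c))%N, 0; split=> //.
  + move=> k; have := fle k; rewrite s1; case: eqP; lia.
  + by rewrite inE eqxx.
  + rewrite big_split /= sumr_const mul0rn addr0 -natr_sum big_split /= s1.
    by rewrite natrD (bigD1 c)//= eqxx big1 ?addn0// => l /negbTE ->.
  + move=> k.
    have -> : \sum_l (a l - (f l)%:R) ^+ 2 = \sum_k x k ^+ 2 by [].
    rewrite addr0 aE natrD opprD addrACA subrr add0r.
    have xc1 := x1 c.
    apply: (@le_trans _ _ (1 - x c)); last by lra.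
    rewrite ler_norml; move: sx1; rewrite big3 /=.
    have := x0 0; have := x0 1; have := x0 2%:R.
    elim/ord3_ind : c xc1 {cmax S}; elim/ord3_ind : k => /= *; apply/andP; split; lra.
- have sx2 : \sum_k x k = 2 by rewrite sx -s2 -natr1; ring.
  (* y gives the barycentric coordinates in the triangle; its side y c = 0 is
     the nearest one, and p is the triangle across it *)
  have [i [j [ci cj ij cijP big_cij]]] := ord3_split c.
  pose p k := (f k + (k == c))%N.
  pose y k := 1 - x k.
  have y0 k : 0 <= y k by rewrite /y; have := x1 k => ?; lra.
  have yc k : y c <= y k by rewrite /y; have := cmax k => ?; lra.
  have aEy k : a k = (f k)%:R + 1 - y k by rewrite aE /y; ring.
  have sy : y i + y j + y c = 1.
    by move: sx2; rewrite big_cij /= /y => ?; lra.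
  have ps : (\sum_k p k = m)%N.
    by rewrite -s2 !big_cij /p /= eqxx !(eq_sym _ c) (negbTE ci) (negbTE cj); lia.
  have pG : 1 - \sum_l (a l - (p l)%:R) ^+ 2 = 2 * (y i * y j - y c ^+ 2).
    rewrite big_cij /p /= eqxx !(eq_sym _ c) (negbTE ci) (negbTE cj) !addn0.
    rewrite !aEy natrD mulr1n.
    have -> : y c = 1 - y i - y j by lra.
    ring.
  have fs : (f c + f i + f j).+1 = m by rewrite -s2 big_cij.
  have [[d yd]|/forallNP small] := pselect (exists d, 1 / 2 <= y d).
    have yd1 : 1 - y d <= 8 * (y i * y j - y c ^+ 2).
      have := yc i; have := yc j; have := y0 c => ? ? ?.
      case: (cijP d) yd => -> ?; first by exfalso; lra.
        by apply: down_triangle_vertex; lra.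
      by rewrite (mulrC (y i)); apply: down_triangle_vertex; lra.
    exists p, (fun k => f k + (k != d))%N, 0; split=> //.
    + by move=> k; have := fle k; case: eqP; lia.
    + by rewrite inE eqxx.
    + rewrite big_split /= sumr_const mul0rn addr0 -natr_sum big_split /=.
      have -> : (\sum_k (k != d) = 2)%N by rewrite big3; elim/ord3_ind : d {yd yd1}.
      by rewrite natrD -s2 -natr1; ring.
    + move=> k; rewrite pG.
      have -> : a k - ((f k + (k != d))%:R + 0) = (k == d)%:R - y k.
        by rewrite aEy natrD; case: eqP => _ /=; ring.
      apply: (@le_trans _ _ (1 - y d)); last by lra.
      have [->|kd] := eqVneq k d.
        by rewrite ger0_norm// subr_ge0 /y gerBl.
      rewrite sub0r normrN ger0_norm//.
      have syy : \sum_k y k = 1 by rewrite big_cij /=; lra.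
      move: syy; rewrite (bigD1 d)//= (bigD1 k)//= => syy.
      have : 0 <= \sum_(i | (i != d) && (i != k)) y i by exact: sumr_ge0.
      by lra.
  exists p, f, (2 / 3); split=> //.
  + by move=> k; have := fle k; lia.
  + by rewrite !inE eqxx orbT.
  + rewrite big_cij /=; have -> : M = (f c + f i + f j)%:R + 1 by rewrite -fs -natr1.
    by rewrite !natrD; field.
  + move=> k; rewrite pG aEy.
    have yi : y i <= 1 / 2 by rewrite leNgt; apply/negP => /ltW; exact: small.
    have yj : y j <= 1 / 2 by rewrite leNgt; apply/negP => /ltW; exact: small.
    have := yc i; have := yc j; have := y0 c => hc hj hi.
    have B1 : y i - y c <= 8 * (y i * y j - y c ^+ 2).
      by apply: down_triangle_center; lra.
    have B2 : y j - y c <= 8 * (y i * y j - y c ^+ 2).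
      by rewrite (mulrC (y i)); apply: down_triangle_center; lra.
    have -> : (f k)%:R + 1 - y k - ((f k)%:R + 2 / 3) = 1 / 3 - y k.
      by field.
    by rewrite ler_norml; case: (cijP k) => ->; apply/andP; split; lra.
Qed.

(** A superset of the ideal vertices; only finiteness and the membership of the
vertices given by [nearest_vertex] matter. *)
Definition cusps : seq 'rV[R]_3 :=
  apex R :: [seq ideal_point (fun k => (f k)%:R + c)
            | f : {ffun 'I_3 -> 'I_m.+2} <- enum {: {ffun 'I_3 -> 'I_m.+2}},
              c : R <- [:: 0; 2 / 3]].

Lemma sqrt3_le2 : 0 <= sqrt3 R <= 2.
Proof.
rewrite sqrtr_ge0 -(@ler_pXn2r _ 2)// ?nnegrE ?sqrtr_ge0//.
by rewrite sqrt3_sqr expr2; lra.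
Qed.

Lemma ox_le1 k : `|ox R k| <= 1.
Proof. by rewrite /ox ler_norml; elim/ord3_ind : k => /=; apply/andP; split; lra. Qed.

Lemma oy_le1 k : `|oy R k| <= 1.
Proof.
have /andP[? ?] := sqrt3_le2.
by rewrite /oy ler_norml; elim/ord3_ind : k => /=; apply/andP; split; lra.
Qed.

Lemma weighted_bound (a o : 'I_3 -> R) (B : R) :
  (forall k, `|o k| <= 1) -> (\sum_k `|a k| <= B) ->
  `|2 / 3 * \sum_k a k * o k| <= 2 / 3 * B.
Proof.
move=> o1 aB; rewrite normrM ger0_norm ?ler_pM2l//; try by lra.
apply: le_trans aB; apply: (le_trans (ler_norm_sum _ _ _)).
by apply: ler_sum => k _; rewrite normrM ler_piMr.
Qed.

Lemma z_bound (a : 'I_3 -> R) : (forall k, 0 <= a k) -> \sum_k a k = N ->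
  `|zx a| <= N /\ `|zy a| <= N.
Proof.
move=> a0 aN; have M0 : 0 <= M by [].
have aa : \sum_k `|a k| <= N.
  by rewrite -aN; apply: ler_sum => k _; rewrite ger0_norm.
have := weighted_bound ox_le1 aa; have := weighted_bound oy_le1 aa.
by rewrite /zx /zy => ? ?; split; lra.
Qed.

Lemma z_diff (a b : 'I_3 -> R) (t : R) : (forall k, `|a k - b k| <= t) ->
  `|zx a - zx b| <= 2 * t /\ `|zy a - zy b| <= 2 * t.
Proof.
move=> ab.
have aa : \sum_k `|a k - b k| <= 3 * t.
  by rewrite big3 /=; have := ab 0; have := ab 1; have := ab 2%:R => ? ? ?; lra.
have := weighted_bound ox_le1 aa; have := weighted_bound oy_le1 aa.
rewrite /zx /zy -!mulrBr -!sumrB.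
have E (o : 'I_3 -> R) : \sum_k (a k - b k) * o k = \sum_k (a k * o k - b k * o k).
  by apply: eq_bigr => k _; rewrite mulrBl.
by rewrite !E => ? ?; split; lra.
Qed.

Lemma sqr_diff (u v t B : R) : `|u - v| <= t -> `|u| <= B -> `|v| <= B ->
  `|u ^+ 2 - v ^+ 2| <= t * (2 * B).
Proof.
move=> uv uB vB; rewrite subr_sqr normrM; apply: ler_pM => //.
by apply: (le_trans (ler_normD _ _)); lra.
Qed.

Lemma height_gt0 x : H3 x -> 0 < height x.
Proof.
rewrite /H3/= dot3 /height => x1.
have := sqr_ge0 (x 0 0); have := sqr_ge0 (x 0 1) => h1 h2.
rewrite subr_gt0 ltNge; apply/negP => h.
have : 1 * 1 <= x 0 2%:R * x 0 2%:R by apply: ler_pM.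
by rewrite -!expr2 in x1 *; lra.
Qed.

Lemma zx_bary x : 0 < height x ->
  zx (fun k => bary m k x / height x) * height x = x 0 0.
Proof.
move=> h0; rewrite /zx big3 /= /bary /ox /oy /=; field.
by rewrite gt_eqF.
Qed.

Lemma zy_bary x : 0 < height x ->
  zy (fun k => bary m k x / height x) * height x = x 0 1.
Proof.
move=> h0; rewrite /zy big3 /= /bary /ox /oy /=.
have := sqrt3_sqr R; move: (sqrt3 R) => s s2.
transitivity (s ^+ 2 / 3 * x 0 1); last by rewrite s2; field.
by field; rewrite gt_eqF.
Qed.

(** In the half-space model, let [t] be the square of the height of [x] above its
projection.  Then [1 - dot x x = t * height x ^+ 2], the constraints bound the
depth of the projection in any circle by a multiple of [t], so [nearest_vertex]
gives an ideal vertex at distance [O (t * height x)].  This suffices unless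
[height x] is small, where [x] is at distance [O (height x)] from the apex while
[t * height x] is at least 1. *)
Lemma cusp_bound : exists2 C : R, 0 < C &
  forall x, H3 x ->
    (forall k, dot (side_plane R m k).1 x <= (side_plane R m k).2) ->
    (forall p : 'I_3 -> nat, (\sum_k p k = m)%N ->
      dot (circle_plane m (fun k => (p k)%:R)).1 x
        <= (circle_plane m (fun k => (p k)%:R)).2) ->
    exists2 v, v \in cusps &
      forall l, `|x 0 l - v 0 l| <= C * (1 - dot x x).
Proof.
have M0 : 0 <= M by [].
pose C1 := 1 + 48 * N; pose C2 := 12 + (N + 1) * C1; pose K := 1 + 2 * N ^+ 2.
have C10 : 0 < C1 by rewrite /C1; lra.
have NC1 : 0 < (N + 1) * C1 by rewrite mulr_gt0//; lra.
have NN1 : 0 <= N * C1 by rewrite mulr_ge0//; lra.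
have C20 : 0 < C2 by rewrite /C2; lra.
have NN : 0 <= N ^+ 2 by exact: sqr_ge0.
have K1 : 1 <= K by rewrite /K; lra.
exists (C2 * K); first by rewrite mulr_gt0//; lra.
move=> x Hx sides circles; set D := 1 - dot x x.
have D0 : 0 < D by rewrite subr_gt0.
have h0 := height_gt0 Hx; set h := height x in h0 *.
have hn0 : h != 0 by rewrite gt_eqF.
pose a k := bary m k x / h.
have a0 k : 0 <= a k.
  by rewrite divr_ge0 ?(ltW h0)// -side_planeE subr_ge0.
have aN : \sum_k a k = N by rewrite -mulr_suml bary_sum mulfK.
pose t := D / h ^+ 2.
have t0 : 0 < t by rewrite divr_gt0// exprn_gt0.
have tD : t * h ^+ 2 = D by rewrite divfK// expf_neq0.
have zxE : zx a * h = x 0 0 by exact: zx_bary.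
have zyE : zy a * h = x 0 1 by exact: zy_bary.
(* zz a + t is the coordinate (1 + x_2) / (1 - x_2), so t is the square of
   the height of x over its projection in the half-space model *)
have E1 : (1 + (zz a + t)) * h = 2.
  apply: (mulIf hn0).
  transitivity (h ^+ 2 + (zx a * h) ^+ 2 + (zy a * h) ^+ 2 + t * h ^+ 2).
    by rewrite /zz; ring.
  by rewrite zxE zyE tD /D dot3 /h /height; ring.
have zza0 : 0 <= zz a by rewrite addr_ge0 ?sqr_ge0.
have [zxN zyN] := z_bound a0 aN.
have sqN (u : R) : `|u| <= N -> u ^+ 2 <= N ^+ 2.
  by move=> uN; rewrite -real_normK ?num_real// ler_pXn2r ?nnegrE//; lra.
have zzN : zz a <= 2 * N ^+ 2.
  by rewrite /zz; have := sqN _ zxN; have := sqN _ zyN => ? ?; lra.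
(* small height: x is close to the apex *)
have [hK|hK] := leP h K^-1.
  exists (apex R); first by rewrite inE eqxx.
  have Kh : K * h <= 1 by rewrite mulrC -ler_pdivlMr ?mul1r//; lra.
  have hD : h <= D.
    rewrite -tD; have -> : t * h ^+ 2 = h * (2 - h - zz a * h).
      by rewrite -[2]E1; ring.
    rewrite ler_peMr ?(ltW h0)//.
    have : zz a * h <= 2 * N ^+ 2 * h by rewrite ler_pM2r.
    by rewrite /K in Kh; lra.
  have big : N <= C2 * K.
    have : C2 * 1 <= C2 * K by rewrite ler_pM2l.
    have : (N + 1) * 1 <= (N + 1) * C1 by rewrite ler_pM2l /C1; lra.
    by rewrite /C2; lra.
  have bound (u : R) : `|u| <= N * h -> `|u| <= C2 * K * D.
    by move=> /le_trans; apply; apply: ler_pM; rewrite ?(ltW h0)//; lra.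
  have zb (u : R) : `|u| <= N -> `|u * h| <= N * h.
    by move=> uN; rewrite normrM (gtr0_norm h0) ler_pM2r.
  elim/ord3_ind => /=; rewrite mxE /= ?subr0; apply: bound.
  - by rewrite -zxE; exact: zb.
  - by rewrite -zyE; exact: zb.
  - rewrite distrC -/(height x) -/h (gtr0_norm h0) ler_peMl ?(ltW h0)//; lra.
have [p [f [c [ps fm cc bN near]]]] := nearest_vertex a0 aN.
pose b k := (f k)%:R + c : R.
exists (ideal_point b).
  rewrite inE; apply/orP; right; apply/allpairsP.
  exists ([ffun k => inord (f k)], c); split=> //=; first by rewrite mem_enum.
  congr ideal_point; apply/funext => k; rewrite /b ffunE inordK//.
  by rewrite ltnS fm.
have pM : \sum_k (p k)%:R = M by rewrite -natr_sum ps.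
have near6 k : `|a k - b k| <= 6 * t.
  apply: (le_trans (near k)).
  have := circle_planeE x pM.
  have : 0 <= 2 * height x * ((circle_plane m (fun k => (p k)%:R)).2
      - dot (circle_plane m (fun k => (p k)%:R)).1 x).
    by rewrite mulr_ge0 ?subr_ge0 ?circles// mulr_ge0// ltW.
  move=> /[swap] -> .
  have -> : \sum_k0 (bary m k0 x - (p k0)%:R * height x) ^+ 2
     = (\sum_k (a k - (p k)%:R) ^+ 2) * h ^+ 2.
    rewrite mulr_suml; apply: eq_bigr => l _.
    by rewrite -exprMn mulrBl /a divfK.
  rewrite -/h -/D -tD => E.
  have : 0 <= (\sum_k (a k - (p k)%:R) ^+ 2 - 1 + 3 / 2 * t) * h ^+ 2 by lra.
  by rewrite pmulr_lge0 ?exprn_gt0// => ?; lra.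
have b0 k : 0 <= b k.
  by move: cc; rewrite /b !inE => /orP[] /eqP ->; rewrite ?addr0// addr_ge0//; lra.
have [bxN byN] := z_bound b0 bN.
have [dx dy] := z_diff near6.
have dzz : `|zz a - zz b| <= 48 * N * t.
  have := sqr_diff dx zxN bxN; have := sqr_diff dy zyN byN.
  rewrite /zz !ler_norml => /andP[? ?] /andP[? ?]; apply/andP; split; lra.
pose hb := height (ideal_point b).
have zb1 := zz1_gt0 b.
have hbE : hb * (zz b + 1) = 2 by rewrite /hb ideal_point_height divfK// gt_eqF.
have dh : `|h - hb| <= C1 * t * h.
  have zb0 : 0 <= zz b by rewrite addr_ge0 ?sqr_ge0.
  have e : (h - hb) * (zz b + 1) = h * (zz b - zz a - t).
    by rewrite mulrBl hbE -E1; ring.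
  have : `|h - hb| * (zz b + 1) <= h * (C1 * t).
    rewrite -[X in _ * X](gtr0_norm zb1) -normrM e normrM (gtr0_norm h0) ler_pM2l//.
    move: dzz; rewrite /C1 !ler_norml => /andP[? ?]; apply/andP; split; lra.
  move=> h1.
  have : 0 <= `|h - hb| * zz b by rewrite mulr_ge0.
  by lra.
have fin (u : R) : `|u| <= C2 * t * h -> `|u| <= C2 * K * D.
  move=> /le_trans; apply; rewrite -tD.
  have -> : C2 * K * (t * h ^+ 2) = C2 * t * h * (K * h) by ring.
  apply: ler_peMr; first by rewrite ltW// (mulr_gt0 (mulr_gt0 C20 t0) h0).
  by rewrite mulrC -ler_pdivrMr ?div1r ?ltW//; lra.
have xy (u v : R) : `|u - v| <= 2 * (6 * t) -> `|v| <= N ->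
    `|u * h - v * hb| <= C2 * t * h.
  move=> uv vN; have -> : u * h - v * hb = (u - v) * h + v * (h - hb) by ring.
  apply: (le_trans (ler_normD _ _)); rewrite !normrM (gtr0_norm h0).
  have e1 : `|u - v| * h <= 2 * (6 * t) * h by rewrite ler_pM2r.
  have e2 : `|v| * `|h - hb| <= N * (C1 * t * h) by apply: ler_pM.
  have e3 := mulr_gt0 (mulr_gt0 C10 t0) h0.
  by rewrite /C2; lra.
have hv k (z : R) : 2 * z / (zz b + 1) = z * hb.
  by rewrite /hb ideal_point_height; field; rewrite gt_eqF.
elim/ord3_ind; apply: fin.
- by rewrite mxE /= (hv 0) -zxE; exact: xy.
- by rewrite mxE /= (hv 0) -zyE; exact: xy.
- have -> : x 0 2%:R - ideal_point b 0 2%:R = - (h - hb) by rewrite /h /hb /height; ring.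
  have e3 := mulr_ge0 (mulr_ge0 NN1 (ltW t0)) (ltW h0).
  have e4 := mulr_gt0 t0 h0.
  by rewrite normrN; apply: (le_trans dh); rewrite /C2; lra.
Qed.

End CuspBound.

(** * Counting the cells of the honeycomb *)

Section Cells.
Local Close Scope classical_set_scope.
Variable m : nat.
Implicit Types (k l : 'I_3).

(** The triple [p] stands for the unit triangle on which [p k <= a k] for all [k];
its corners are obtained by adding 1 to one of the coordinates. *)
Definition cell : finType :=
  {p : {ffun 'I_3 -> 'I_m.+1} | (\sum_k p k == m)%N}.
Implicit Types (p q : cell) (f : 'I_3 -> nat).

Definition cell_coord p k : nat := val p k.

Lemma cell_sum p : (\sum_k cell_coord p k = m)%N.
Proof. exact: eqP (valP p). Qed.

Lemma cell_inj p q : (forall k, cell_coord p k = cell_coord q k) -> p = q.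
Proof. by move=> pq; apply/val_inj/ffunP => k; apply/val_inj/pq. Qed.

Lemma cell_of f : (\sum_k f k = m)%N -> {p : cell | forall k, cell_coord p k = f k}.
Proof.
move=> fm; have lt k : (f k < m.+1)%N by rewrite ltnS -fm (bigD1 k)//= leq_addr.
have sm : (\sum_k [ffun k => Ordinal (lt k)] k == m)%N.
  by rewrite -[X in _ == X]fm; apply/eqP/eq_bigr => k _; rewrite ffunE.
by exists (exist _ [ffun k => Ordinal (lt k)] sm) => k; rewrite /cell_coord /= ffunE.
Qed.

Lemma corner_sum (t : 'I_3) : (\sum_k (if k == t then m else 0) = m)%N.
Proof. by rewrite -big_mkcond big_pred1_eq. Qed.

Definition corner t : cell := sval (cell_of (corner_sum t)).

Lemma cornerE t k : cell_coord (corner t) k = if k == t then m else 0%N.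
Proof. exact: (svalP (cell_of (corner_sum t))). Qed.

(** Meaningful only when the values of [f] add up to [m]. *)
Definition mkcell f : cell :=
  insubd (corner 0) [ffun k => inord (f k)].

Lemma mkcellE f k : (\sum_k f k = m)%N -> cell_coord (mkcell f) k = f k.
Proof.
move=> fm; have lt i : (f i < m.+1)%N by rewrite ltnS -fm (bigD1 i)//= leq_addr.
rewrite /cell_coord /mkcell val_insubd ifT ?ffunE ?inordK//.
by rewrite -[X in _ == X]fm; apply/eqP/eq_bigr => i _; rewrite ffunE inordK.
Qed.

(** [q] is obtained from [p] by moving one unit from coordinate [a] to [b], written
without subtraction. *)
Definition touching p q : bool := [exists a, exists b,
  (a != b) && [forall k, cell_coord p k + (k == b) == cell_coord q k + (k == a)]%N].

Lemma touchingP p q : reflect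
  (exists a b, a != b /\ forall k, (cell_coord p k + (k == b) = cell_coord q k + (k == a))%N)
  (touching p q).
Proof.
apply: (iffP existsP) => [[a /existsP[b /andP[ab /forallP h]]]|[a [b [ab h]]]].
  by exists a, b; split=> // k; exact/eqP.
by exists a; apply/existsP; exists b; rewrite ab; apply/forallP => k; apply/eqP.
Qed.

Definition zeros p : nat := #|[set k | cell_coord p k == 0%N]|.

Lemma zerosE p :
  zeros p = ((cell_coord p 0%R == 0%N) + (cell_coord p 1%R == 0%N)
             + (cell_coord p 2%:R == 0%N))%N.
Proof. by rewrite /zeros -sum1dep_card big_mkcond big3. Qed.

Lemma sum_delta l : (\sum_k (k == l) = 1)%N.
Proof. by rewrite (bigD1 l)//= eqxx big1 // => k /negbTE ->. Qed.

(** There are two moves out of every nonzero coordinate. *)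
Lemma card_touching p : (#|[set q | touching p q]| + 2 * zeros p = 6)%N.
Proof.
(* a neighbour is obtained by moving one unit from a nonzero coordinate a to
   another coordinate b *)
pose g (ab : 'I_3 * 'I_3) :=
  mkcell (fun k => cell_coord p k - (k == ab.1) + (k == ab.2))%N.
pose S := [set ab : 'I_3 * 'I_3 | (ab.1 != ab.2) && (0 < cell_coord p ab.1)%N].
have gE ab k : ab \in S ->
    (cell_coord (g ab) k = cell_coord p k - (k == ab.1) + (k == ab.2))%N.
  rewrite inE => /andP[_ p0]; apply: mkcellE.
  rewrite big_split /= sum_delta; have := cell_sum p.
  rewrite (bigD1 ab.1)//= [in X in _ -> X](bigD1 ab.1)//= eqxx.
  have -> : (\sum_(i | i != ab.1) (cell_coord p i - (i == ab.1))
      = \sum_(i | i != ab.1) cell_coord p i)%N.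
    by apply: eq_bigr => i /negbTE ->; rewrite subn0.
  by move=> <-; rewrite addnAC subnK.
have -> : [set q | touching p q] = g @: S.
  apply/setP => q; rewrite inE; apply/touchingP/imsetP.
    move=> [a [b [ab h]]]; exists (a, b).
      rewrite inE /= ab; have := h a; rewrite eqxx (negbTE ab); lia.
    apply: cell_inj => k; rewrite gE /=.
      by have := h k; have [->|_] := eqVneq k a; rewrite ?(negbTE ab); lia.
    by rewrite inE /= ab; have := h a; rewrite eqxx (negbTE ab); lia.
  move=> [[a b] Sab ->]; exists a, b.
  move: (Sab); rewrite inE /= => /andP[ab p0]; split=> // k.
  rewrite gE //=; have [->|_] := eqVneq k a; last by lia.
  by rewrite (negbTE ab); lia.
rewrite card_in_imset; last first.
  move=> [a b] [a' b'] S1 S2 E.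
  have E' k : cell_coord (g (a, b)) k = cell_coord (g (a', b')) k by rewrite E.
  have Ea := E' a; have Ea' := E' a'; have Eb := E' b; have Eb' := E' b'.
  move: Ea Ea' Eb Eb'; rewrite !gE//= !eqxx.
  move: S1 S2; rewrite !inE /= => /andP[ab pa] /andP[ab' pa'].
  rewrite (eq_sym b a) (eq_sym b' a') (negbTE ab) (negbTE ab').
  rewrite (eq_sym a' a) (eq_sym b' b) (eq_sym b' a) (eq_sym a' b).
  have [->|aa] := eqVneq a a'; have [->|bb] := eqVneq b b' => //;
    do ?case: eqP => _; lia.
have -> : #|S| = (\sum_a \sum_b ((a != b) && (0 < cell_coord p a)))%N.
  rewrite -sum1dep_card big_mkcond /= pair_bigA /=.
  by apply: eq_bigr => -[a b] _ /=; case: ifP.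
rewrite zerosE !big3 /=.
by case: (cell_coord p 0%R); case: (cell_coord p 1%R); case: (cell_coord p 2%:R).
Qed.

Lemma card_row k i : (i <= m)%N -> #|[set p | cell_coord p k == i]| = (m - i).+1.
Proof.
move=> im; have [a [b [ka kb ab cases big_kab]]] := ord3_split k.
pose g (j : 'I_(m - i).+1) :=
  mkcell (fun l => if l == k then i else if l == a then j : nat else m - i - j)%N.
have gE j l : cell_coord (g j) l =
    (if l == k then i else if l == a then j : nat else m - i - j)%N.
  apply: mkcellE; rewrite big_kab /= eqxx (eq_sym a k) (negbTE ka) eqxx.
  by rewrite (eq_sym b k) (negbTE kb) (eq_sym b a) (negbTE ab); have := ltn_ord j; lia.
have -> : [set p | cell_coord p k == i] = [set g j | j : 'I_(m - i).+1].
  apply/setP => p; rewrite inE; apply/eqP/imsetP => [pi|[j _ ->]].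
    have pm := cell_sum p; rewrite big_kab /= pi in pm.
    have lt : (cell_coord p a < (m - i).+1)%N by lia.
    exists (Ordinal lt) => //; apply: cell_inj => l; rewrite gE /=.
    case: (cases l) => ->; rewrite ?eqxx ?(eq_sym _ k) ?(negbTE ka) ?(negbTE kb)//.
    by rewrite (eq_sym b a) (negbTE ab); lia.
  by rewrite gE eqxx.
rewrite card_imset ?card_ord// => j j' E; apply/val_inj.
by have := gE j a; rewrite E gE (eq_sym a k) (negbTE ka) eqxx.
Qed.

Lemma card_cell : (2 * #|cell| = m.+1 * m.+2)%N.
Proof.
have -> : #|cell| = (\sum_(i < m.+1) (m - i).+1)%N.
  rewrite -sum1_card (partition_big (fun p : cell => val p 0%R) predT)//=.
  apply: eq_bigr => i _; have im : (i <= m)%N by rewrite -ltnS.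
  by rewrite -(card_row 0%R im) -sum1dep_card.
elim: m => [|n IH]; first by rewrite big_ord1.
rewrite big_ord_recl /= mulnDr subn0.
under eq_bigr do rewrite /bump /= add1n subSS.
by rewrite IH; lia.
Qed.

Lemma zeros_le2 p : (0 < m)%N -> (zeros p <= 2)%N.
Proof.
move=> m0; have := cell_sum p; rewrite big3 /= zerosE.
by case: (cell_coord p 0%R) (cell_coord p 1%R) (cell_coord p 2%:R) => [|?] [|?] [|?] /=; lia.
Qed.

Lemma cornerP t p : (forall k, k != t -> cell_coord p k = 0%N) -> p = corner t.
Proof.
move=> h; apply: cell_inj => k; rewrite cornerE; case: eqVneq => [->|/h//].
have := cell_sum p; rewrite (bigD1 t)//= big1 ?addn0// => l; exact: h.
Qed.

Lemma corner_inj : (0 < m)%N -> injective corner.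
Proof.
move=> m0 s t st; apply/eqP; have := cornerE s s; rewrite st cornerE eqxx.
by case: eqP => // _; lia.
Qed.

Lemma zeros_corner t : (0 < m)%N -> zeros (corner t) = 2%N.
Proof.
move=> m0; rewrite zerosE !cornerE.
by elim/ord3_ind : t => /=; rewrite ?(gtn_eqF m0); case: m m0.
Qed.

Lemma card_zeros2 : (0 < m)%N -> #|[set p | zeros p == 2]| = 3%N.
Proof.
move=> m0; have -> : [set p | zeros p == 2] = [set corner t | t : 'I_3].
  apply/setP => p; rewrite inE; apply/eqP/imsetP => [|[t _ ->]]; last first.
    exact: zeros_corner.
  rewrite zerosE => z.
  have [e|[e|e]] : (cell_coord p 0%R = 0 /\ cell_coord p 1%R = 0)%N \/
      (cell_coord p 0%R = 0 /\ cell_coord p 2%:R = 0)%N \/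
      (cell_coord p 1%R = 0 /\ cell_coord p 2%:R = 0)%N.
    by move: z; do 3?case: eqP => ?; lia.
  - exists 2%:R => //; apply: cornerP; by elim/ord3_ind => //; case: e.
  - exists 1 => //; apply: cornerP; by elim/ord3_ind => //; case: e.
  - exists 0 => //; apply: cornerP; by elim/ord3_ind => //; case: e.
by rewrite card_imset ?card_ord//; exact: corner_inj.
Qed.

(** Double counting: the three rows of [m.+1] cells along the sides of the triangle
cover a cell as often as it has zero coordinates, and the cells with two zeros
are the three corners. *)
Lemma card_zeros : (0 < m)%N ->
  #|[set p | zeros p == 1]| = (3 * m.-1)%N /\
  #|[set p | zeros p == 0%N]| = (((m - 2) * m.-1) %/ 2)%N.
Proof.
move=> m0; have c2 := card_zeros2 m0.
have sumz : (\sum_p zeros p = 3 * m.+1)%N.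
  under eq_bigr do rewrite /zeros -sum1dep_card big_mkcond.
  rewrite exchange_big /=.
  under eq_bigr do rewrite -big_mkcond sum1dep_card card_row// subn0.
  by rewrite sum_nat_const card_ord.
have ind c : #|[set p | zeros p == c]| = (\sum_p (zeros p == c))%N.
  by rewrite -sum1dep_card big_mkcond /=; apply: eq_bigr => p _; case: eqP.
have s1 : (\sum_p zeros p
    = #|[set p | zeros p == 1]| + 2 * #|[set p | zeros p == 2]|)%N.
  rewrite !ind big_distrr /= -big_split /=; apply: eq_bigr => p _.
  by have := zeros_le2 p m0; case: (zeros p) => [|[|[|]]].
have s0 : (#|cell| = #|[set p | zeros p == 0%N]| + #|[set p | zeros p == 1]|
                   + #|[set p | zeros p == 2]|)%N.
  rewrite !ind -!big_split /= -sum1_card; apply: eq_bigr => p _.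
  by have := zeros_le2 p m0; case: (zeros p) => [|[|[|]]].
have T := card_cell.
rewrite sumz c2 in s1.
have c1 : #|[set p | zeros p == 1]| = (3 * m.-1)%N.
  by apply/eqP; rewrite -(eqn_add2r (2 * 3)) -s1; lia.
split=> //; move: T; rewrite s0 c1 c2.
set c := #|_| => T; have -> : ((m - 2) * m.-1 = c * 2)%N by nia.
by rewrite mulnK.
Qed.

End Cells.

(** * The honeycomb polyhedron *)

Section Honeycomb.
Variables (R : realType) (m : nat).
Local Notation M := (m%:R : R).
Local Notation N := (M + 1).
Local Notation index := ('I_3 + cell m)%type.
Implicit Types (i j : index) (k l t : 'I_3) (p q : cell m).

Definition cellR p k : R := (cell_coord p k)%:R.

Lemma cellR_sum p : \sum_k cellR p k = M.
Proof. by rewrite -natr_sum cell_sum. Qed.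

Definition face_normal i : 'rV[R]_3 * R :=
  match i with inl k => side_plane R m k | inr p => circle_plane m (cellR p) end.

Definition abut i j : bool :=
  match i, j with
  | inl k, inl l => k != l
  | inl k, inr p | inr p, inl k => cell_coord p k == 0%N
  | inr p, inr q => touching p q
  end.

Lemma sqdist_int (f g : 'I_3 -> nat) :
  \sum_k ((f k)%:R - (g k)%:R) ^+ 2
  = (\sum_k ((f k)%:Z - (g k)%:Z) ^+ 2)%:~R :> R.
Proof.
rewrite rmorph_sum; apply: eq_bigr => k _.
by rewrite rmorphXn rmorphB /= -!pmulrn.
Qed.

Lemma sqdist_ge1 (f g : 'I_3 -> nat) : (\sum_k f k != \sum_k g k)%N ->
  1 <= \sum_k ((f k)%:R - (g k)%:R) ^+ 2 :> R.
Proof.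
move=> fg; rewrite sqdist_int -[1]/(1%:~R) ler_int.
have [k /eqP fgk] : exists k, f k != g k.
  apply: contrapT => /forallNP h; move/eqP: fg; apply; apply: eq_bigr => k _.
  by apply/eqP/negPn/negP; exact: h.
rewrite (bigD1 k)//=.
have h1 : 1 <= ((f k)%:Z - (g k)%:Z) ^+ 2.
  have : (f k)%:Z - (g k)%:Z != 0 by lia.
  by move=> h; rewrite -sqrf_eq0 in h; have := sqr_ge0 ((f k)%:Z - (g k)%:Z); lia.
apply: (le_trans h1); rewrite lerDl; apply: sumr_ge0 => l _; exact: sqr_ge0.
Qed.

Lemma sqdist_touching p q : touching p q ->
  \sum_k (cellR p k - cellR q k) ^+ 2 = 2.
Proof.
move=> /touchingP[a [b [ab h]]].
have E k : cellR p k - cellR q k = (k == a)%:R - (k == b)%:R.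
  have := congr1 (fun n : nat => n%:R : R) (h k); rewrite !natrD /cellR => ?; lra.
rewrite big3 /= !E.
by elim/ord3_ind : a ab {h E}; elim/ord3_ind : b => //= _; ring.
Qed.

(** Two distinct triples of the same sum at squared distance less than 3 differ by
at most 1 in each coordinate, so one unit has been moved. *)
Lemma sqdist_apart p q : p != q -> ~~ touching p q ->
  3 <= \sum_k (cellR p k - cellR q k) ^+ 2.
Proof.
move=> pq nt; rewrite sqdist_int -[3]/(3%:~R) ler_int leNgt; apply/negP => lt3.
have near1 k : (cell_coord p k <= (cell_coord q k).+1)%N /\
               (cell_coord q k <= (cell_coord p k).+1)%N.
  move: lt3; rewrite (bigD1 k)//=.
  have : 0 <= \sum_(l | l != k) ((cell_coord p l)%:Z - (cell_coord q l)%:Z) ^+ 2.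
    by apply: sumr_ge0 => l _; exact: sqr_ge0.
  by move: (\sum_(l | _) _) => r; rewrite expr2; clear; nia.
have ne : ~ (forall k, cell_coord p k = cell_coord q k).
  by move/cell_inj => pq'; rewrite pq' eqxx in pq.
have nt' a b : a != b ->
    ~ (forall k, (cell_coord p k + (k == b) = cell_coord q k + (k == a))%N).
  by move=> ab h; move/negP: nt; apply; apply/touchingP; exists a, b.
have all3 (Q : 'I_3 -> Prop) : ~ (forall k, Q k) -> ~ (Q 0 /\ Q 1 /\ Q 2%:R).
  by move=> nQ [? [? ?]]; apply: nQ; elim/ord3_ind.
move: (all3 _ ne) (all3 _ (nt' 0 1 isT)) (all3 _ (nt' 1 0 isT))
  (all3 _ (nt' 0 2%:R isT)) (all3 _ (nt' 2%:R 0 isT))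
  (all3 _ (nt' 1 2%:R isT)) (all3 _ (nt' 2%:R 1 isT)) => /=.
move: (near1 0) (near1 1) (near1 2%:R) (cell_sum p) (cell_sum q).
rewrite !big3 /=; clear.
move: (cell_coord p 0%R) (cell_coord p 1%R) (cell_coord p 2%:R).
move: (cell_coord q 0%R) (cell_coord q 1%R) (cell_coord q 2%:R).
lia.
Qed.

Lemma vertex_ok (f : 'I_3 -> nat) (c : R) : 0 <= c ->
  \sum_k ((f k)%:R + c) = N ->
  (forall p, 1 <= \sum_k ((f k)%:R + c - cellR p k) ^+ 2) ->
  forall i, dot (face_normal i).1 (ideal_point (fun k => (f k)%:R + c))
            <= (face_normal i).2.
Proof.
move=> c0 fN far [k|p].
  by apply: side_ideal_point => //; exact: addr_ge0.
by apply: circle_ideal_point_le => //; exact: cellR_sum.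
Qed.

Lemma lattice_sum (f : 'I_3 -> nat) : (\sum_k f k = m.+1)%N ->
  \sum_k ((f k)%:R + 0) = N.
Proof. by move=> fm; under eq_bigr do rewrite addr0; rewrite -natr_sum fm natr1. Qed.

Lemma lattice_ok (f : 'I_3 -> nat) : (\sum_k f k = m.+1)%N ->
  forall i, dot (face_normal i).1 (ideal_point (fun k => (f k)%:R + 0)) <= (face_normal i).2.
Proof.
move=> fm; apply: vertex_ok => // [|p]; first exact: lattice_sum.
under eq_bigr do rewrite addr0; apply: sqdist_ge1.
by rewrite fm cell_sum; lia.
Qed.

(** Adding 2/3 to all the coordinates moves [f] to the plane of the triangle without
changing the square distance to [p], which is therefore an integer. *)
Lemma center_sqdist (f : 'I_3 -> nat) p : ((\sum_k f k).+1 = m)%N ->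
  \sum_k ((f k)%:R + 2 / 3 - cellR p k) ^+ 2
  = \sum_k ((f k)%:R - cellR p k) ^+ 2 :> R.
Proof.
move=> fm; have := cellR_sum p; rewrite -fm -natr1 natr_sum !big3 /= => E.
have -> : cellR p 2%:R = (f 0)%:R + (f 1)%:R + (f 2%:R)%:R + 1 - cellR p 0 - cellR p 1.
  by lra.
by field.
Qed.

Lemma center_sum (f : 'I_3 -> nat) : ((\sum_k f k).+1 = m)%N ->
  \sum_k ((f k)%:R + 2 / 3) = N.
Proof.
move=> fm; have -> : M = (\sum_k f k)%:R + 1 by rewrite natr1 fm.
by rewrite natr_sum !big3 /=; field.
Qed.

Lemma center_ok (f : 'I_3 -> nat) : ((\sum_k f k).+1 = m)%N ->
  forall i, dot (face_normal i).1 (ideal_point (fun k => (f k)%:R + 2 / 3))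
            <= (face_normal i).2.
Proof.
move=> fm; apply: vertex_ok => [||p]; [lra|exact: center_sum|].
rewrite center_sqdist//; apply: sqdist_ge1.
by rewrite cell_sum -fm neq_ltn ltnSn.
Qed.

Lemma apex_ok i : dot (face_normal i).1 (apex R) <= (face_normal i).2.
Proof. by case: i => [k|p] /=; [rewrite side_apex | rewrite ltW// circle_apex]. Qed.

Lemma bump_sum p t : (\sum_k (cell_coord p k + (k == t)) = m.+1)%N.
Proof. by rewrite big_split /= sum_delta cell_sum addn1. Qed.

Lemma bump_on p t (f := fun k => (cell_coord p k + (k == t))%N) :
  dot (face_normal (inr p)).1 (ideal_point (fun k => (f k)%:R + 0)) = (face_normal (inr p)).2.
Proof.
apply: circle_ideal_point_eq; [exact: lattice_sum (bump_sum p t)|exact: cellR_sum|].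
transitivity ((\sum_k (k == t))%:R : R); last by rewrite sum_delta.
rewrite natr_sum; apply: eq_bigr => k _.
rewrite /f /cellR natrD addr0 addrC addKr.
by case: (k == t); rewrite ?expr1n ?expr0n.
Qed.

(** A vertical edge, from a corner of the triangle to infinity. *)
Lemma ends_sides k l : k != l -> exists w1 w2,
  [/\ w1 != w2, dot w1 w1 = 1, dot w2 w2 = 1,
      (forall i, dot (face_normal i).1 w1 <= (face_normal i).2 /\
                 dot (face_normal i).1 w2 <= (face_normal i).2) &
      [/\ dot (face_normal (inl k)).1 w1 = (face_normal (inl k)).2,
          dot (face_normal (inl l)).1 w1 = (face_normal (inl l)).2,
          dot (face_normal (inl k)).1 w2 = (face_normal (inl k)).2 &
          dot (face_normal (inl l)).1 w2 = (face_normal (inl l)).2]].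
Proof.
move=> kl.
have [t tk tl] : exists2 t, k != t & l != t.
  have [i [j [ki kj ij cases _]]] := ord3_split k.
  case: (cases l) kl => ->; rewrite ?eqxx// => _.
    by exists j.
  by exists i; rewrite // eq_sym.
pose f u := (if u == t then m.+1 else 0)%N.
have fm : (\sum_u f u = m.+1)%N by rewrite -big_mkcond big_pred1_eq.
have fN := lattice_sum fm.
exists (ideal_point (fun u => (f u)%:R + 0)), (apex R); split.
- exact: ideal_point_neq_apex.
- exact: ideal_point_norm.
- exact: apex_norm.
- by move=> i; split; [exact: lattice_ok | exact: apex_ok].
- split; rewrite ?side_apex//; apply: side_ideal_point_eq => //;
    by rewrite /f ?(negbTE tk) ?(negbTE tl) addr0.
Qed.

(** The edge over the side [k] of the unit triangle [p]. *)
Lemma ends_side_cell k p : cell_coord p k = 0%N -> exists w1 w2,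
  [/\ w1 != w2, dot w1 w1 = 1, dot w2 w2 = 1,
      (forall i, dot (face_normal i).1 w1 <= (face_normal i).2 /\
                 dot (face_normal i).1 w2 <= (face_normal i).2) &
      [/\ dot (face_normal (inl k)).1 w1 = (face_normal (inl k)).2,
          dot (face_normal (inr p)).1 w1 = (face_normal (inr p)).2,
          dot (face_normal (inl k)).1 w2 = (face_normal (inl k)).2 &
          dot (face_normal (inr p)).1 w2 = (face_normal (inr p)).2]].
Proof.
move=> pk; have [a [b [ka kb ab _ _]]] := ord3_split k.
have sN t := lattice_sum (bump_sum p t).
exists (ideal_point (fun u => (cell_coord p u + (u == a))%:R + 0)),
       (ideal_point (fun u => (cell_coord p u + (u == b))%:R + 0)); split.
- apply/eqP => /(ideal_point_inj a (sN a) (sN b)) /eqP.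
  by rewrite !addr0 eqxx (negbTE ab) eqr_nat; lia.
- exact: ideal_point_norm.
- exact: ideal_point_norm.
- by move=> i; split; exact: lattice_ok (bump_sum p _) i.
- split; try exact: bump_on; apply: side_ideal_point_eq; try exact: sN;
    by rewrite pk ?(negbTE ka) ?(negbTE kb) addr0.
Qed.

(** Neighbouring circles meet at the node common to their unit triangles and at the
centre of the triangle of opposite orientation that is adjacent to both. *)
Lemma ends_cells p q : touching p q -> exists w1 w2,
  [/\ w1 != w2, dot w1 w1 = 1, dot w2 w2 = 1,
      (forall i, dot (face_normal i).1 w1 <= (face_normal i).2 /\
                 dot (face_normal i).1 w2 <= (face_normal i).2) &
      [/\ dot (face_normal (inr p)).1 w1 = (face_normal (inr p)).2,
          dot (face_normal (inr q)).1 w1 = (face_normal (inr q)).2,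
          dot (face_normal (inr p)).1 w2 = (face_normal (inr p)).2 &
          dot (face_normal (inr q)).1 w2 = (face_normal (inr q)).2]].
Proof.
move=> /touchingP[a [b [ab h]]].
pose f u := (cell_coord p u - (u == a))%N.
have pa : (0 < cell_coord p a)%N by have := h a; rewrite eqxx (negbTE ab); lia.
have fp u : (f u + (u == a) = cell_coord p u)%N.
  by rewrite /f; case: eqP => [->|_]; lia.
have fq u : (f u + (u == b) = cell_coord q u)%N by have := h u; have := fp u; lia.
have fm : ((\sum_u f u).+1 = m)%N.
  have := cell_sum p; under eq_bigr do rewrite -fp.
  by rewrite big_split /= sum_delta addn1.
have fN := center_sum fm.
have on r t : (forall u, (f u + (u == t) = cell_coord r u)%N) ->
    dot (face_normal (inr r)).1 (ideal_point (fun k => (f k)%:R + 2 / 3))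
    = (face_normal (inr r)).2.
  move=> fr; apply: circle_ideal_point_eq => //; first exact: cellR_sum.
  rewrite center_sqdist//.
  transitivity ((\sum_k (k == t))%:R : R); last by rewrite sum_delta.
  rewrite natr_sum; apply: eq_bigr => k _.
  rewrite /cellR -fr natrD opprD addrA subrr sub0r sqrrN.
  by case: (k == t); rewrite ?expr1n ?expr0n.
exists (ideal_point (fun u => (cell_coord p u + (u == b))%:R + 0)),
       (ideal_point (fun u => (f u)%:R + 2 / 3)); split.
- apply/eqP => /(ideal_point_inj a (lattice_sum (bump_sum p b)) fN).
  rewrite (negbTE ab) -fp eqxx !addn0 natrD mulr1n.
  move: (f a)%:R => z zE; clear - zE; lra.
- exact: ideal_point_norm.
- exact: ideal_point_norm.
- by move=> i; split; [exact: lattice_ok (bump_sum p b) i | exact: center_ok].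
- split; [exact: bump_on| |exact: on fp|exact: on fq].
  have -> : (fun u => (cell_coord p u + (u == b))%:R + 0)
      = (fun u => (cell_coord q u + (u == a))%:R + 0) :> ('I_3 -> R).
    by apply/funext => u; rewrite h.
  exact: bump_on.
Qed.

Lemma card_abut_side k : #|[set j | abut (inl k) j]%SET| = m.+3.
Proof.
rewrite -sum1dep_card big_sumType /= !sum1dep_card card_row// subn0.
have -> : #|[set l | k != l]%SET| = 2%N; last by lia.
by rewrite -sum1dep_card big_mkcond big3; elim/ord3_ind : k.
Qed.

Lemma card_abut_cell p :
  (#|[set j | abut (inr p) j]%SET| + zeros p = 6)%N.
Proof.
rewrite -sum1dep_card big_sumType /= !sum1dep_card -/(zeros p).
by rewrite addnAC addnn -mul2n addnC; exact: card_touching.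
Qed.

Lemma zeros_le3 p : (zeros p <= 3)%N.
Proof. by rewrite -[leqRHS](card_ord 3) max_card. Qed.

Lemma honeycomb_family : equiangular_family face_normal abut.
Proof.
split.
- move=> [k|p] /=; first by rewrite side_side eqxx.
  rewrite circle_circle ?cellR_sum// big1 ?mulr0 ?subr0// => k _.
  by rewrite subrr expr0n.
- move=> [k|p] [l|q] /= a.
  + by rewrite side_side (negbTE a).
  + by rewrite side_circle ?cellR_sum// /cellR (eqP a) mulr0 oppr0 sub0r.
  + by rewrite lorentzC side_circle ?cellR_sum// /cellR (eqP a) mulr0 oppr0 sub0r.
  + by rewrite circle_circle ?cellR_sum// sqdist_touching//; field.
- have far k p : cell_coord p k != 0%N ->
      lorentz (side_plane R m k) (circle_plane m (cellR p)) <= -1.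
    rewrite -lt0n -(ler_nat R) => h; rewrite side_circle ?cellR_sum// /cellR.
    by clear - h; lra.
  move=> [k|p] [l|q] ij a /=.
  + by move: ij a => /= /negP ij /negPn/eqP kl; case: ij; rewrite kl.
  + exact: far.
  + by rewrite lorentzC; exact: far.
  + rewrite circle_circle ?cellR_sum//.
    have pq : p != q by apply: contra ij => /eqP ->.
    have h := sqdist_apart pq a; clear - h; lra.
- move=> [k|p]; first exact: side_origin.
  by apply: circle_origin; exact: cellR_sum.
- move=> [k|p] [l|q] a.
  + exact: ends_sides.
  + by apply: ends_side_cell; apply/eqP.
  + have [w1 [w2 [? ? ? ? [? ? ? ?]]]] := ends_side_cell (eqP a).
    by exists w1, w2; split.
  + exact: ends_cells.
- move=> i j.
  have : (0 < #|[set k | abut i k]%SET :\ j|)%N.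
    have := cardsD1 j [set k | abut i k]%SET.
    have : (2 < #|[set k | abut i k]%SET|)%N.
      case: i => [k|p]; first by rewrite card_abut_side.
      by rewrite -(leq_add2r (zeros p)) card_abut_cell; have := zeros_le3 p; lia.
    by case: (_ \in _); lia.
  by case/card_gt0P => k; rewrite !inE => /andP[kj ik]; exists k.
Qed.

Definition honeycomb_polyhedron : set 'rV[R]_3 := family_polyhedron face_normal.
Local Notation P := honeycomb_polyhedron.
Local Notation F := (family_face face_normal).

Lemma honeycomb_finite_volume : (hyp_volume P < +oo)%E.
Proof.
have [C C0 bound] := cusp_bound R m.
apply: (@finite_hyp_volume _ _ (cusps R m) C) => //; first by move=> x [].
move=> x [Hx Px]; apply: bound => //.
  by move=> k; exact: Px (inl k).
move=> f fm; have [p pf] := cell_of fm.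
have -> : (fun k => (f k)%:R) = cellR p.
  by apply/funext => k; rewrite /cellR pf.
exact: Px (inr p).
Qed.

Lemma honeycomb_equiangular : equiangular P (pi / 3).
Proof. exact: family_equiangular honeycomb_family honeycomb_finite_volume. Qed.

(** The planes of the circles do not pass through the apex. *)
Lemma face_at_apex i : closure (F i) (apex R) <-> exists k, i = inl k.
Proof.
split=> [|[k ->]].
  case: i => [k|p] cl; first by exists k.
  exfalso; have : closure [set x | dot (face_normal (inr p)).1 x
                                   = (face_normal (inr p)).2] (apex R).
    by apply: closureS cl => x [_ []].
  move=> /closed_plane /= E.
  by have := circle_apex m (cellR p); rewrite E ltxx.
apply: (ideal_closure honeycomb_family); first exact: apex_norm.
  exact: apex_ok.
exact: side_apex.
Qed.

Lemma adjacentP i j : adjacent_faces P (F i) (F j) <-> abut i j.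
Proof. exact: adjacent_facesP honeycomb_family i j. Qed.

Lemma faceP G : is_face P G <-> exists i, G = F i.
Proof. exact: is_faceP honeycomb_family G. Qed.

Lemma face_inj : injective F.
Proof. exact: family_face_inj honeycomb_family. Qed.

Lemma side_gon k : is_gon P (F (inl k)) m.+3.
Proof. by rewrite -(card_abut_side k); exact: face_gon honeycomb_family (inl k). Qed.

Lemma cell_gon p c : zeros p = c -> is_gon P (F (inr p)) (6 - c).
Proof.
move=> <-; have := face_gon honeycomb_family (inr p).
by rewrite -(card_abut_cell p) addnK.
Qed.

Lemma card_cell_faces (S : {set cell m}) :
  [set F (inr p) | p in [set` S]] #= `I_#|S|.
Proof.
apply: card_eq_trans (inj_card_eq _) (card_set_fin S).
by move=> p q _ _ /face_inj[].
Qed.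

Lemma honeycomb_tetrahedron : m = 0%N -> tetrahedron P.
Proof.
move=> m0; split.
  have -> : 4%N = #|{: index}|; last exact: family_face_count honeycomb_family.
  by rewrite card_sum card_ord; have := card_cell m; rewrite [in RHS]m0 => ?; lia.
move=> G /faceP[[k|p] ->]; first by have := side_gon k; rewrite [m.+3](_ : _ = 3%N) ?m0.
have z3 : zeros p = 3%N.
  have := cell_sum p; rewrite zerosE big3 /=.
  by case: (cell_coord p 0%R) (cell_coord p 1%R) (cell_coord p 2%:R)
    => [|?] [|?] [|?] //=; lia.
by have := cell_gon z3.
Qed.

(** The only circle touching two sides is that of the unit triangle in the corner
between them. *)
Lemma corner_face k l t : (0 < m)%N -> k != l -> k != t -> l != t ->
  [set G | [/\ is_face P G, adjacent_faces P G (F (inl k)),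
               adjacent_faces P G (F (inl l)) & G <> F (inl t)]]
  = [set F (inr (corner m t))].
Proof.
move=> m0 kl kt lt; apply/seteqP; split=> G /=; last first.
  move=> ->; split; first by apply/faceP; exists (inr (corner m t)).
  - by apply/adjacentP; rewrite /= cornerE (negbTE kt).
  - by apply/adjacentP; rewrite /= cornerE (negbTE lt).
  - by move/face_inj.
move=> [/faceP[i ->] /adjacentP ik /adjacentP il it].
have cases u : u != t -> u = k \/ u = l.
  move: kl kt lt.
  by elim/ord3_ind : k {ik}; elim/ord3_ind : l {il}; elim/ord3_ind : t {it};
    elim/ord3_ind : u => //=; auto.
case: i ik il it => [u|p] /= ik il it.
  have [ut|/cases[uk|ul]] := eqVneq u t; first by case: it; rewrite ut.
    by rewrite uk eqxx in ik.
  by rewrite ul eqxx in il.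
congr (F (inr _)); apply: cornerP => u /cases[->|->]; exact/eqP.
Qed.

End Honeycomb.

Theorem mainTheorem2 (R : realType) (n : nat) (hn : (1 <= n)%N) :
  exists P : set 'rV[R]_3,
    [/\ equiangular P (pi / 3),
        n = 1%N -> tetrahedron P &
        (2 <= n)%N ->
        exists (v0 : 'rV[R]_3) (A1 A2 A3 B1 B2 B3 : set 'rV[R]_3),
        [/\ ideal_vertex P v0,
            (* (i) *)
            [/\ A1 <> A2, A2 <> A3, A3 <> A1,
                [set F | is_face P F /\ closure F v0] = [set A1; A2; A3] &
                forall F, [set A1; A2; A3] F -> is_gon P F (n + 2)%N],
            (* (ii) *)
            [/\ [set F | [/\ is_face P F, adjacent_faces P F A1, adjacent_faces P F A2
                          & F <> A3]] = [set B1],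
                [set F | [/\ is_face P F, adjacent_faces P F A2, adjacent_faces P F A3
                          & F <> A1]] = [set B2],
                [set F | [/\ is_face P F, adjacent_faces P F A3, adjacent_faces P F A1
                          & F <> A2]] = [set B3],
                [/\ B1 <> B2, B2 <> B3 & B3 <> B1] &
                forall F, [set B1; B2; B3] F -> is_gon P F 4],
            (* (iii) *)
            let T := [set F | [/\ is_face P F,
                                  ~ [set A1; A2; A3] F,
                                  ~ [set B1; B2; B3] F &
                                  exists! A, [set A1; A2; A3] A
                                             /\ adjacent_faces P F A]] in
            (forall F, T F -> is_gon P F 5) /\ T #= `I_(3 * (n - 2))%N &
            (* (iv) *)
            let T := [set F | [/\ is_face P F,
                                  ~ [set A1; A2; A3] F &
                                  forall A, [set A1; A2; A3] A ->
                                            ~ adjacent_faces P F A]] in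
            (forall F, T F -> is_gon P F 6)
            /\ T #= `I_(((n - 3) * (n - 2)) %/ 2)%N]].
Proof.
case: n hn => [//|m] _; exists (@honeycomb_polyhedron R m); split.
- exact: honeycomb_equiangular.
- by move=> [m0]; exact: honeycomb_tetrahedron.
move=> m0; have {m0} m0 : (0 < m)%N by [].
pose F := family_face (@face_normal R m).
pose A k := F (inl k); pose B t := F (inr (corner m t)).
(* the corner t is opposite to the side t and touches the two other sides *)
exists (apex R), (A 0), (A 1), (A 2%:R), (B 2%:R), (B 0), (B 1).
have setA G : [set A 0; A 1; A 2%:R] G <-> exists k, G = A k.
  split=> [[[]|] ->|[k ->]]; [by exists 0|by exists 1|by exists 2%:R|].
  by elim/ord3_ind : k; [left; left|left; right|right].
have setB G : [set B 2%:R; B 0; B 1] G <-> exists t, G = B t.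
  split=> [[[]|] ->|[k ->]]; [by exists 2%:R|by exists 0|by exists 1|].
  by elim/ord3_ind : k; [left; right|right|left; left].
have Ainj k l : A k = A l -> k = l by move/face_inj => [].
have Binj k l : B k = B l -> k = l by move/face_inj => [/(corner_inj m0)].
have adjA p k : adjacent_faces (@honeycomb_polyhedron R m) (F (inr p)) (A k)
    <-> cell_coord p k = 0%N.
  by split=> [/adjacentP/eqP|h]; last by apply/adjacentP/eqP.
have notA p : ~ [set A 0; A 1; A 2%:R] (F (inr p)).
  by move=> /setA[k] /face_inj.
have closA k : closure (A k) (apex R) by apply/face_at_apex; exists k.
split.
- split; first exact: apex_norm.
  by apply: closureS (closA 0) => x [].
- split; try by move/Ainj.
    apply/seteqP; split=> G.
      move=> [/faceP[i ->] /face_at_apex[k ->]]; apply/setA; by exists k.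
    move=> /setA[k ->]; split; last exact: closA.
    by apply/faceP; exists (inl k).
  move=> G /setA[k ->]; rewrite (_ : (m.+1 + 2 = m.+3)%N); last by lia.
  exact: side_gon.
- split; try exact: corner_face; first by split; move/Binj.
  move=> G /setB[t ->]; rewrite (_ : 4%N = (6 - 2)%N)//.
  by apply: cell_gon; exact: zeros_corner.
- set T := [set G | _].
  have TE : T = [set F (inr p) | p in [set` [set p | zeros p == 1%N]%SET]].
    apply/seteqP; split=> G.
      move=> [/faceP[[l|p] ->] nA nB].
        by case: nA; apply/setA; exists l.
      move=> [_ [[/setA[k ->] /adjA pk] uniq]].
      exists p => //=; rewrite inE; apply/cards1P; exists k.
      apply/setP => l; rewrite !inE; apply/eqP/eqP => [pl|-> //].
      by apply/esym/Ainj/uniq; split; [apply/setA; exists l|apply/adjA].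
    move=> [p /=]; rewrite inE => z1 <-; split=> //.
    - by apply/faceP; exists (inr p).
    - move=> /setB[t /face_inj[pt]].
      by move: z1; rewrite pt zeros_corner.
    - have /cards1P[k kE] := z1; exists (A k); split.
        split; first by apply/setA; exists k.
        by apply/adjA/eqP; have /setP/(_ k) := kE; rewrite !inE eqxx.
      move=> _ [/setA[l ->] /adjA pl]; congr A; apply/esym/eqP.
      by have /setP/(_ l) := kE; rewrite !inE pl eqxx => <-.
  have [c1 _] := card_zeros m0; split.
    rewrite TE => _ [p /= zp <-]; apply: (@cell_gon _ _ _ 1).
    by move: zp; rewrite inE => /eqP.
  have -> : (3 * (m.+1 - 2) = #|[set p : cell m | zeros p == 1%N]%SET|)%N.
    by rewrite c1; congr (3 * _)%N; lia.
  by rewrite TE; exact: card_cell_faces.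
- set T := [set G | _].
  have TE : T = [set F (inr p) | p in [set` [set p | zeros p == 0%N]%SET]].
    apply/seteqP; split=> G.
      move=> [/faceP[[k|p] ->] nA nadj].
        by case: nA; apply/setA; exists k.
      exists p => //=; rewrite inE; apply/eqP/eqP; rewrite cards_eq0.
      apply/eqP/setP => k; rewrite !inE; apply/eqP => pk.
      by apply: (nadj (A k)); [apply/setA; exists k|apply/adjA].
    move=> [p /=]; rewrite inE => z0 <-; split=> //.
      by apply/faceP; exists (inr p).
    move=> _ /setA[k ->] /adjA pk; move: z0; rewrite cards_eq0 => /eqP/setP/(_ k).
    by rewrite !inE pk.
  have [_ c0] := card_zeros m0; split.
    rewrite TE => _ [p /= zp <-]; apply: (@cell_gon _ _ _ 0).
    by move: zp; rewrite inE => /eqP.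
  have -> : ((m.+1 - 3) * (m.+1 - 2) %/ 2
      = #|[set p : cell m | zeros p == 0%N]%SET|)%N.
    by rewrite c0; congr (_ * _ %/ _)%N; lia.
  by rewrite TE; exact: card_cell_faces.
Qed.
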